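(* Let $N\ge1$, $p=(p_1,\ldots,p_N)$ with each $p_k\in(0,1)$, and $\pi=(\pi_1,\ldots,\pi_N)$ with $\pi_k=p_k/(1-p_k)$. For $n\ge 0$, let $Q_n$ be the $n$-step transition kernel of the Markov chain $Y$ in each of Cases A, B, C, D defined in the context, and let $P_n$ be the kernel on $W^N_{\ge0}$ given by $$P_n(z,z')=\prod_{k=1}^N[1-p_k]^n\,\frac{s_{z'}(p)}{s_z(p)}\det\{w_n(z'_i-z_j-i+j)\}_{i,j=1}^N\quad\text{in Cases A and C},$$ $$P_n(z,z')=\prod_{k=1}^N[1-p_k]^n\,\frac{s_{z'}(\pi)}{s_z(\pi)}\det\{v_n(z'_i-z_j-i+j)\}_{i,j=1}^N\quad\text{in Cases B and D}.$$ Then, for every $n\ge0$, the following intertwining relations hold: - Case A: $P_n\hat K_p=\hat K_pQ_n$; - Case B: $P_nK_\pi=K_\pi Q_n$; - Case C: $P_nK_p=K_pQ_n$; - Case D: $P_n\hat K_\pi=\hat K_\pi Q_n$. Here, for instance, $P_n\hat K_p=\hat K_pQ_n$ means $\sum_{z'\in W^N_{\ge0}}P_n(z,z')\hat K_p(z',y)=\sum_{y'\in\hat W^N}\hat K_p(z,y')Q_n(y',y)$ for all $z\in W^N_{\ge0}$, $y\in\hat W^N$; for the relations involving $K$, replace $\hat W^N$ by $W^N$.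
   Context: State spaces: $W^N=\{z\in\mathbf Z^N: z_N\le\cdots\le z_1\}$, $\hat W^N=\{z\in\mathbf Z^N: z_1\le\cdots\le z_N\}$, and $W^N_{\ge0}=\{z\in W^N: z_N\ge0\}$ (partitions with at most $N$ nonzero parts). The four processes. Let $(\xi(k,n);\,1\le k\le N,\ n\ge1)$ be independent random variables. ''Geometric'' means $\mathbf P(\xi(k,n)=r)=(1-p_k)p_k^r$ for $r=0,1,2,\ldots$; ''Bernoulli'' means $\mathbf P(\xi(k,n)=1)=p_k=1-\mathbf P(\xi(k,n)=0)$. In every case $Y_1(n)=Y_1(n-1)+\xi(1,n)$, and for $k=2,\ldots,N$: - Case A ($\xi$ geometric, $Y$ in $\hat W^N$): $Y_k(n)=\max(Y_k(n-1),Y_{k-1}(n))+\xi(k,n)$. - Case B ($\xi$ Bernoulli, $Y$ in $W^N$): $Y_k(n)=\min(Y_k(n-1)+\xi(k,n),\,Y_{k-1}(n))$. - Case C ($\xi$ geometric, $Y$ in $W^N$): $Y_k(n)=\min(Y_k(n-1)+\xi(k,n),\,Y_{k-1}(n-1))$. - Case D ($\xi$ Bernoulli, $Y$ in $\hat W^N$): $Y_k(n)=\max(Y_k(n-1)+\xi(k,n),\,Y_{k-1}(n))$. $Q_n(y,y')=\mathbf P(Y(n)=y'\mid Y(0)=y)$. Functions: $w_n(k)=\binom{n-1+k}{k}\mathbf 1(k\ge0;\,n\ge0)$ (so $w_0(k)=\mathbf 1(k=0)$) and $v_n(k)=\binom nk\mathbf 1(0\le k\le n;\,n\ge0)$. Tableaux: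 $\mathbf T$ denotes the set of semi-standard Young tableaux with entries in $\{1,\ldots,N\}$ (weakly increasing along rows, strictly increasing down columns), which have at most $N$ rows. For $T\in\mathbf T$: $\mathrm{sh}(T)\in W^N_{\ge0}$ is its shape padded with zeros; $\mathrm{ledge}(T)\in W^N$ is the vector whose $i$th entry is the number of $i$'s in row $i$; $\mathrm{redge}(T)\in\hat W^N$ is the vector whose $i$th entry is the number of entries in the first row that are at most $i$; and for a vector $\alpha=(\alpha_1,\ldots,\alpha_N)$ of positive weights, $\alpha^T=\prod_{i=1}^N\alpha_i^{n_i(T)}$, where $n_i(T)$ is the number of $i$'s in $T$. The Schur polynomial is $s_z(\alpha)=\sum_{T\in\mathbf T:\,\mathrm{sh}(T)=z}\alpha^T$. Kernels: for $z\in W^N_{\ge0}$, $$K_\alpha(z,y)=\frac1{s_z(\alpha)}\sum_{T\in\mathbf T:\ \mathrm{sh}(T)=z,\ \mathrm{ledge}(T)=y}\alpha^T\quad(y\in W^N),\qquad \hat K_\alpha(z,y)=\frac1{s_z(\alpha)}\sum_{T\in\mathbf T:\ \mathrm{sh}(T)=z,\ \mathrm{redge}(T)=y}\alpha^T\quad(y\in\hat W^N).$$ *)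

(* Defs.v *)
From HB Require Import structures.
From mathcomp Require Import all_boot all_order all_algebra finmap.
From mathcomp Require Import all_classical all_reals all_analysis.

Set Implicit Arguments.
Unset Strict Implicit.
Unset Printing Implicit Defensive.

Import Order.TTheory GRing.Theory Num.Theory.

Local Open Scope classical_set_scope.
Local Open Scope ring_scope.

(* Indices 1, ..., N are represented by the ordinals 0, ..., N - 1. *)
Notation Zvec N := {ffun 'I_N -> int} (only parsing).

Definition W (N : nat) : set (Zvec N) :=
  [set z | forall i j : 'I_N, (i <= j)%N -> z j <= z i].

Definition What (N : nat) : set (Zvec N) :=
  [set z | forall i j : 'I_N, (i <= j)%N -> z i <= z j].

Definition Wge0 (N : nat) : set (Zvec N) :=
  [set z | W z /\ forall i : 'I_N, i.+1 = N :> nat -> 0 <= z i].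

(* [local yk yk' yk'new x] computes Y_k(n) from yk = Y_k(n-1),
   yk' = Y_{k-1}(n-1), yk'new = Y_{k-1}(n) and x = xi(k,n). *)
Definition update_rule := int -> int -> int -> int -> int.

Definition ruleA : update_rule := fun yk _ yk'new x => Num.max yk yk'new + x.
Definition ruleB : update_rule := fun yk _ yk'new x => Num.min (yk + x) yk'new.
Definition ruleC : update_rule := fun yk yk' _ x => Num.min (yk + x) yk'.
Definition ruleD : update_rule := fun yk _ yk'new x => Num.max (yk + x) yk'new.

(* Junk value 0 outside the index range. *)
Definition coord (N : nat) (y : 'I_N -> int) (k : nat) : int :=
  oapp y 0 (insub k).

Fixpoint step_coord (g : update_rule) (y x : nat -> int) (k : nat) : int :=
  match k with
  | 0%N => y 0%N + x 0%N
  | k'.+1 => g (y k) (y k') (step_coord g y x k') (x k)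
  end.

Definition step (N : nat) (g : update_rule) (y : Zvec N) (x : 'I_N -> int) :
  Zvec N := [ffun k : 'I_N => step_coord g (coord y) (coord x) k].

Lemma coordE (N : nat) (y : 'I_N -> int) (k : 'I_N) : coord y k = y k.
Proof. by rewrite /coord valK. Qed.

Lemma step_first (N : nat) g (y : Zvec N) x (k : 'I_N) :
  k = 0%N :> nat -> step g y x k = y k + x k.
Proof.
by move=> k0; rewrite ffunE -(coordE y) -(coordE x) k0.
Qed.

Lemma step_next (N : nat) g (y : Zvec N) x (k k' : 'I_N) :
  k = k'.+1 :> nat -> step g y x k = g (y k) (y k') (step g y x k') (x k).
Proof.
by move=> kS; rewrite !ffunE -(coordE y k) -(coordE y k') -(coordE x) kS.
Qed.

(* The chain started at y; the values xi k 0 are never used. *)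
Fixpoint chain (N : nat) (Omega : Type) (g : update_rule)
    (xi : 'I_N -> nat -> Omega -> nat) (y : Zvec N) (n : nat) (w : Omega) :
    Zvec N :=
  match n with
  | 0%N => y
  | m.+1 => step g (chain g xi y m w) (fun k => (xi k m.+1 w)%:Z)
  end.

Definition Q (R : realType) (d : measure_display) (Omega : measurableType d)
    (P : probability Omega R) (N : nat) (g : update_rule)
    (xi : 'I_N -> nat -> {RV P >-> nat}) (n : nat) (y y' : Zvec N) : R :=
  fine (P [set w | chain g (fun k m => xi k m : Omega -> nat) y n w = y']).

Definition mutually_independent (R : realType) (d d' : measure_display)
    (Omega : measurableType d) (T : measurableType d')
    (P : probability Omega R) (I : choiceType) (D : set I)
    (X : I -> {RV P >-> T}) : Prop :=
  forall (J : {fset I}) (B : I -> set T),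
    [set` J] `<=` D -> (forall i, i \in J -> measurable (B i)) ->
    P (\bigcap_(i in [set` J]) (X i @^-1` B i)) =
    (\prod_(i <- J) fine (P (X i @^-1` B i)))%:E.

Definition independent_noise (R : realType) (d : measure_display)
    (Omega : measurableType d) (P : probability Omega R) (N : nat)
    (xi : 'I_N -> nat -> {RV P >-> nat}) : Prop :=
  mutually_independent [set kn : 'I_N * nat | (1 <= kn.2)%N]
    (fun kn => xi kn.1 kn.2).

Definition geometric_noise (R : realType) (d : measure_display)
    (Omega : measurableType d) (P : probability Omega R) (N : nat)
    (p : 'I_N -> R) (xi : 'I_N -> nat -> {RV P >-> nat}) : Prop :=
  forall (k : 'I_N) (n : nat), (1 <= n)%N -> forall r : nat,
    P [set w | xi k n w = r] = ((1 - p k) * p k ^+ r)%:E.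

Definition bernoulli_noise (R : realType) (d : measure_display)
    (Omega : measurableType d) (P : probability Omega R) (N : nat)
    (p : 'I_N -> R) (xi : 'I_N -> nat -> {RV P >-> nat}) : Prop :=
  forall (k : 'I_N) (n : nat), (1 <= n)%N ->
    P [set w | xi k n w = 1%N] = (p k)%:E /\
    P [set w | xi k n w = 0%N] = (1 - p k)%:E.

(* The truncated predecessor gives 'C(0, 0) = 1 at n = k = 0 and
   'C(k - 1, k) = 0 at n = 0 < k, so that w_0(k) is 1 at k = 0 only. *)
Definition wfun (R : realType) (n : nat) (k : int) : R :=
  match k with
  | Posz m => ('C((n + m).-1, m))%:R
  | Negz _ => 0
  end.

Definition vfun (R : realType) (n : nat) (k : int) : R :=
  match k with
  | Posz m => ('C(n, m))%:R
  | Negz _ => 0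
  end.

(* A tableau is the list of its rows, without empty rows. *)
Definition fits_below (N : nat) (u v : seq 'I_N) : bool :=
  (size v <= size u)%N && all (fun ab : 'I_N * 'I_N => ab.1 < ab.2)%N (zip u v).

Definition semistandard (N : nat) (T : seq (seq 'I_N)) : bool :=
  [&& [::] \notin T,
      all (sorted (fun a b : 'I_N => a <= b)%N) T &
      sorted (@fits_below N) T].

Definition sh (N : nat) (T : seq (seq 'I_N)) : Zvec N :=
  [ffun i : 'I_N => (size (nth [::] T i))%:Z].

Definition ledge (N : nat) (T : seq (seq 'I_N)) : Zvec N :=
  [ffun i : 'I_N => (count_mem i (nth [::] T i))%:Z].

Definition redge (N : nat) (T : seq (seq 'I_N)) : Zvec N :=
  [ffun i : 'I_N =>
     (count (fun a : 'I_N => a <= i)%N (nth [::] T 0))%:Z].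

Definition weight (R : realType) (N : nat) (alpha : 'I_N -> R)
    (T : seq (seq 'I_N)) : R :=
  \prod_(i < N) alpha i ^+ count_mem i (flatten T).

Definition schur (R : realType) (N : nat) (alpha : 'I_N -> R) (z : Zvec N) :
    R :=
  \sum_(T \in [set T : seq (seq 'I_N) | semistandard T /\ sh T = z])
     weight alpha T.

Definition edge_kernel (R : realType) (N : nat)
    (edge : seq (seq 'I_N) -> Zvec N) (alpha : 'I_N -> R) (z y : Zvec N) : R :=
  (schur alpha z)^-1 *
  \sum_(T \in [set T : seq (seq 'I_N) |
                [/\ semistandard T, sh T = z & edge T = y]])
     weight alpha T.

Definition K (R : realType) (N : nat) := @edge_kernel R N (@ledge N).
Definition Khat (R : realType) (N : nat) := @edge_kernel R N (@redge N).

Definition Pkernel (R : realType) (N : nat) (p alpha : 'I_N -> R)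
    (f : nat -> int -> R) (n : nat) (z z' : Zvec N) : R :=
  (\prod_(k < N) (1 - p k) ^+ n) * (schur alpha z' / schur alpha z) *
  \det (\matrix_(i < N, j < N) f n (z' i - z j - (i : nat)%:Z + (j : nat)%:Z)).

(* [esum] is meant for nonnegative families; the family is split into its
   positive and negative parts.  The value is finite exactly when the family is
   summable ([+oo - +oo] is [-oo]). *)
Definition ssum (R : realType) (I : choiceType) (D : set I) (f : I -> R) :
    \bar R :=
  (\esum_(i in D) ((EFin \o f)^\+ i) - \esum_(i in D) ((EFin \o f)^\- i))%E.

Definition intertwines (R : realType) (N : nat) (S : set (Zvec N))
    (P L M : Zvec N -> Zvec N -> R) : Prop :=
  forall z y, @Wge0 N z -> S y ->
    ssum (@Wge0 N) (fun z' => P z z' * L z' y) =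
    ssum S (fun y' => L z y' * M y' y).

(* Main.v *)
(** A semistandard tableau is a Gelfand-Tsetlin pattern: the shapes formed by its
    entries [<= k], [k = 1, ..., N], interlace, and [redge] and [ledge] collect
    the first, respectively the last, parts of these shapes.  Row operations and
    multilinearity of the determinant show that [P_(n+1)] is [P_n] followed by
    the kernel supported on horizontal strips (Cases A, C) or vertical strips
    (Cases B, D), so that by the Markov property of [Y] one step suffices.

    In one step, the [k]-th edge coordinate depends only on edges of the old and
    new patterns at levels [k - 1] and [k].  By induction on [k] the claim
    reduces to an identity in which the old row [la] of level [k] and the new row
    [mu'] of level [k - 1] are fixed: the sum of [alpha_k ^ (|la| - |mu| + x)]
    over the old rows [mu] of level [k - 1] and the increments [x] is the sum of
    [alpha_k ^ (|la'| - |mu'|)] over the new rows [la'] of level [k].  In Cases A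
    and C, [mu_i] and [la'_(i+1)] range over the same interval, and reversing
    these intervals matches the two sides; in Cases B and D both sides are
    products over the parts of the rows, which telescope. *)

Require Import Defs.
From HB Require Import structures.
From mathcomp Require Import all_boot all_order all_algebra finmap.
From mathcomp Require Import all_classical all_reals all_analysis.
From mathcomp Require Import fingroup perm zify ring.

Set Implicit Arguments.
Unset Strict Implicit.
Unset Printing Implicit Defensive.

Import Order.TTheory GRing.Theory Num.Theory.

Local Open Scope classical_set_scope.
Local Open Scope ring_scope.
Local Notation coord := Defs.coord.

(** Both noise laws have the form [P (xi k m = x) = (1 - p k) * alpha k ^+ x] for [x] in a set [X]
    of increments, with [alpha = p] in the geometric case and [alpha = pi_] in the Bernoulli case;
    this is where the odds [p / (1 - p)] come from. The increment thus enters the local identity as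
    one more exponent of [alpha_k], and the four cases differ only in that identity, in the edge and
    in the recursion of the determinant. The intertwining is proved for the numerators [edge_sum] of
    the kernels, since the factor [schur alpha z'] of [Pkernel] cancels the denominator of the
    kernel at [z']. The sums over [z'] and over increments can be infinite and are exchanged
    repeatedly, so they are taken in [[0, +oo]], where no summability has to be checked. This
    requires nonnegative determinants, which their definition does not show; nonnegativity comes
    from the recursion in [n] itself. In the induction on levels the rule reads coordinate [k - 1]
    of the new state, while the local identity reads the edge of the new row [mu']; the two agree on
    the patterns that contribute. *)

(** * Sums of nonnegative extended reals *)

Section ExtendedSums.
Context {R : realType}.
Local Open Scope ereal_scope.

(** Tonelli for inner index sets that depend on the outer index: both iterated sums run over the
    same set of pairs. *)
Lemma esum_exchange (I J : choiceType) (A : set I) (B : I -> set J)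
    (B' : set J) (A' : J -> set I) (a : I -> J -> \bar R) :
  (forall i j, 0 <= a i j) ->
  (forall i j, A i /\ B i j <-> B' j /\ A' j i) ->
  \esum_(i in A) \esum_(j in B i) a i j =
  \esum_(j in B') \esum_(i in A' j) a i j.
Proof.
move=> a0 AB; rewrite !esum_esum//.
rewrite (@reindex_esum _ _ _ (A `*`` B) (B' `*`` A') (fun k => (k.2, k.1)))//.
split=> [[i j] /= /AB//|[i j] [i' j'] _ _ /= [-> ->]//|[j i] /= /AB ij].
by exists (i, j).
Qed.

Lemma esum_fiber (I J : choiceType) (A : set I) (B : set J) (e : I -> J)
    (a : I -> \bar R) :
  (forall i, 0 <= a i) -> (forall i, A i -> B (e i)) ->
  \esum_(i in A) a i = \esum_(j in B) \esum_(i in A `&` [set i | e i = j]) a i.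
Proof.
move=> a0 AB.
rewrite -(@esum_exchange _ _ A (fun i => [set e i]))//.
  by apply: eq_esum => i Ai; rewrite esum_set1.
move=> i j /=; split=> [[Ai ->]|[Bj [Ai <-]]]; last by [].
by split; first exact: AB.
Qed.

Lemma esumZl (I : choiceType) (A : set I) (c : \bar R) (a : I -> \bar R) :
  0 <= c -> (forall i, 0 <= a i) ->
  \esum_(i in A) (c * a i) = c * \esum_(i in A) a i.
Proof.
(* For [c = +oo] both sides are [0] if all terms vanish and [+oo] otherwise; a finite [c] passes
   through the supremum of the finite sums. *)
case: c => [r r0 a0|_ a0|//]; last first.
  have [A0|/existsNP[i /not_implyP[Ai /eqP ai0]]] :=
      pselect (forall i, A i -> a i = 0).
    by rewrite !esum1 ?mule0// => i /A0 ->; rewrite mule0.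
  have ai_gt0 : 0 < a i by rewrite lt_def ai0 a0.
  have le_a (b : I -> \bar R) : (forall j, 0 <= b j) -> b i <= \esum_(j in A) b j.
    move=> b0; apply: esum_ge; exists [set i]; last by rewrite fsbig_set1.
    by split; [exact: finite_set1|move=> _ ->].
  rewrite gt0_mulye ?(lt_le_trans ai_gt0 (le_a _ a0))//.
  apply/eqP; rewrite -leye_eq -[leLHS](gt0_mulye ai_gt0).
  by apply: (le_a (fun j => +oo * a j)) => j; rewrite mule_ge0.
rewrite /esum -ereal_supZl//; last first.
  by apply/set0P; exists (\sum_(x \in set0) a x); exists set0; [exact: fsets_set0|].
congr ereal_sup; apply/seteqP; split=> [_ [X AX <-]|_ [_ [X AX <-] <-]].
  by exists (\sum_(x \in X) a x); [exists X|rewrite ge0_mule_fsumr].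
by exists X => //; rewrite ge0_mule_fsumr.
Qed.

Lemma esumZr (I : choiceType) (A : set I) (c : \bar R) (a : I -> \bar R) :
  0 <= c -> (forall i, 0 <= a i) ->
  \esum_(i in A) (a i * c) = (\esum_(i in A) a i) * c.
Proof.
by move=> c0 a0; rewrite muleC -esumZl//; apply: eq_esum => i _; rewrite muleC.
Qed.

Lemma esum_fset_set (I : choiceType) (A : set I) (a : I -> R) :
  finite_set A -> (forall i, A i -> (0 <= a i)%R) ->
  \esum_(i in A) (a i)%:E = (\sum_(i \in A) a i)%R%:E.
Proof.
move=> Af a0; rewrite esum_fset ?fsumEFin// => i iA.
by rewrite lee_fin a0//; exact: set_mem.
Qed.

Lemma esum_finType (I : finType) (J : choiceType) (P : pred I) (e : I -> J)
    (a : J -> R) :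
  injective e -> (forall i, P i -> (0 <= a (e i))%R) ->
  \esum_(j in [set e i | i in [set i | P i]]) (a j)%:E = (\sum_(i | P i) a (e i))%:E.
Proof.
move=> e_inj a0; rewrite esum_image; last by move=> x y _ _ /e_inj.
rewrite esum_fset_set; [congr (_%:E)|exact: finite_finset|by []].
rewrite (@fsbigE _ _ _ _ _ (enum P)) ?enum_uniq//=.
- rewrite big_enum_cond; apply: eq_bigl => i; rewrite -topredE /=.
  by apply/andb_idr => Pi; rewrite mem_set.
- by move=> i /=; rewrite mem_enum.
- by move=> i /= Pi; rewrite mem_enum -topredE /= Pi.
Qed.

Lemma esum_if0 (I : choiceType) (A B : set I) (a : I -> \bar R) :
  B `<=` A -> (forall i, A i -> ~ B i -> a i = 0) ->
  \esum_(i in A) a i = \esum_(i in B) a i.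
Proof.
move=> BA aB; rewrite esum_mkcond [RHS]esum_mkcond; apply: eq_esum => i _.
have [iB|iB] := boolP (i \in B); first by rewrite mem_set//; apply: BA; exact: set_mem.
case: ifPn => // iA; apply: aB; first exact: set_mem.
by move=> Bi; rewrite mem_set in iB.
Qed.

Lemma ssumE (I : choiceType) (D : set I) (f : I -> R) :
  (forall i, D i -> (0 <= f i)%R) -> ssum D f = \esum_(i in D) (f i)%:E.
Proof.
move=> f0; rewrite /ssum [X in _ - X]esum1 ?sube0.
  by apply: eq_esum => i Di; rewrite funeposE; apply: max_l; rewrite lee_fin f0.
by move=> i Di; rewrite funenegE; apply: max_r; rewrite -EFinN lee_fin oppr_le0 f0.
Qed.
End ExtendedSums.

(** * Integer vectors read as sequences that vanish from index [N] on *)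

Section Coordinates.
Context {N : nat}.
Implicit Types z y mu la : Zvec N.

Definition vec_of (f : nat -> int) : Zvec N := [ffun i : 'I_N => f i].

Lemma coord_out (y : 'I_N -> int) k : (N <= k)%N -> coord y k = 0.
Proof. by move=> Nk; rewrite /coord insubN// -leqNgt. Qed.

Lemma coord_vec (f : nat -> int) k :
  coord (vec_of f) k = if (k < N)%N then f k else 0.
Proof.
case: ltnP => kN; last exact: coord_out.
by rewrite -[k]/(nat_of_ord (Ordinal kN)) coordE ffunE.
Qed.

Lemma coord_inj y z : coord y =1 coord z -> y = z.
Proof. by move=> yz; apply/ffunP => i; rewrite -!coordE. Qed.

(* [coord z N = 0], so the case [k = N.-1] says that the last part is [>= 0];
   the same convention is used in [interlace]. *)
Definition partition_like z := forall k, coord z k.+1 <= coord z k.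

Lemma Wge0E z : Wge0 z <-> partition_like z.
Proof.
split=> [[Wz z0] k|dz].
  have [kN|kN|kN] := ltngtP k.+1 N.
  - have kN' : (k < N)%N by lia.
    rewrite -[k.+1]/(nat_of_ord (Ordinal kN)) -[k in leRHS]/(nat_of_ord (Ordinal kN')).
    by rewrite !coordE; apply: Wz => /=.
  - by rewrite !coord_out//; lia.
  - rewrite coord_out; last by lia.
    have kN' : (k < N)%N by lia.
    by rewrite -[k]/(nat_of_ord (Ordinal kN')) coordE; apply: z0.
have mono (i j : nat) : (i <= j)%N -> coord z j <= coord z i.
  by move=> /subnK <-; elim: (j - i)%N => // m /(le_trans (dz _)).
split=> [i j ij|i iN]; first by rewrite -!coordE mono.
by have := dz i; rewrite iN coord_out// coordE.
Qed.

Lemma partition_mono z i j : partition_like z -> (i <= j)%N -> coord z j <= coord z i.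
Proof.
by move=> dz /subnK <-; elim: (j - i)%N => // m /(le_trans (dz _)).
Qed.

Lemma partition_ge0 z k : partition_like z -> 0 <= coord z k.
Proof.
move=> dz; have := partition_mono dz (leq_maxl k N).
by rewrite coord_out// leq_maxr.
Qed.

(** Used in two roles: between consecutive levels of one pattern and, as the horizontal strip
    relation, between shapes at consecutive times. *)
Definition interlace mu la :=
  forall i : nat, coord la i.+1 <= coord mu i <= coord la i.

Definition vstrip mu la :=
  forall i : nat, coord mu i <= coord la i <= coord mu i + 1.

End Coordinates.

(** * The determinants: value at time [0] and recursion in time *)

Section Determinants.
Context {R : realType} {N : nat}.
Implicit Types z : Zvec N.

Lemma det_sum_rows (T : finType) (F : 'I_N -> T -> 'I_N -> R) :
  \det (\matrix_(i, j) \sum_t F i t j) =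
  \sum_(f : {ffun 'I_N -> T}) \det (\matrix_(i, j) F i (f i) j).
Proof.
rewrite [LHS]/determinant (eq_bigr (fun s : 'S_N => \sum_(f : {ffun 'I_N -> T})
    (-1) ^+ s * \prod_i F i (f i) (s i))).
  rewrite exchange_big; apply: eq_bigr => f _.
  by apply: eq_bigr => s _; congr (_ * _); apply: eq_bigr => i _; rewrite mxE.
move=> s _; rewrite -mulr_sumr -(bigA_distr_bigA (fun i t => F i t (s i))).
by congr (_ * _); apply: eq_bigr => i _; rewrite mxE.
Qed.

Definition strip_det (f : nat -> int -> R) n z z' : R :=
  \det (\matrix_(i < N, j < N) f n (z' i - z j - (i : nat)%:Z + (j : nat)%:Z)).

Lemma det_row0 (A : 'M[R]_N) i : (forall j, A i j = 0) -> \det A = 0.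
Proof. by move=> Ai0; rewrite (expand_det_row A i) big1// => j _; rewrite Ai0 mul0r. Qed.

(** An increasing permutation satisfies [i <= s i]; its inverse is increasing too, which gives the
    reverse inequality. *)
Lemma homo_perm_id (s : 'S_N) :
  (forall i j : 'I_N, (i < j)%N -> (s i < s j)%N) -> s = 1%g.
Proof.
have ge_id (t : 'S_N) : (forall i j : 'I_N, (i < j)%N -> (t i < t j)%N) ->
    forall i : 'I_N, (i <= t i)%N.
  move=> tP [m mN]; elim: m mN => // m IH mN /=.
  have mN' : (m < N)%N by lia.
  have := IH mN'; have := tP (Ordinal mN') (Ordinal mN) (ltnSn m); rewrite /=; lia.
move=> sP; apply/permP => i; rewrite perm1; apply/val_inj/eqP.
rewrite eqn_leq ge_id// andbT.
have := ge_id (s^-1)%g _ (s i); rewrite permK; apply=> j k jk.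
rewrite ltnNge; apply/negP; rewrite leq_eqVlt => /orP[/eqP/val_inj/perm_inj kj|/sP].
  by rewrite kj ltnn in jk.
by rewrite !permKV; lia.
Qed.

(** A nonzero Leibniz term forces [z'_i - i = z_(s i) - s i] for all [i]. Both shifted sequences are
    strictly decreasing, so [s] is increasing, hence the identity, and [z' = z]. *)
Lemma strip_det0 (f : nat -> int -> R) z z' :
  (forall k, f 0%N k = (k == 0)%:R) -> Wge0 z -> Wge0 z' ->
  strip_det f 0 z z' = (z' == z)%:R.
Proof.
move=> f0 /Wge0E dz /Wge0E dz'.
have [->|zz'] := eqVneq z' z.
  rewrite /strip_det (_ : \matrix_(_, _) _ = 1%:M) ?det1//.
  apply/matrixP => i j; rewrite !mxE f0; congr (nat_of_bool _)%:R.
  apply/eqP/eqP => [|->]; last by lia.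
  move=> ij; apply/val_inj.
  case: (ltngtP i j) => // lt_ij; have := partition_mono dz (ltnW lt_ij);
    rewrite !coordE; lia.
rewrite /strip_det /determinant big1// => s _.
apply/eqP; rewrite mulf_eq0 signr_eq0/=; apply/negPn/negP => /prodf_neq0 nz.
have zs i : z' i - (i : nat)%:Z = z (s i) - (s i : nat)%:Z.
  by have := nz i isT; rewrite mxE f0 pnatr_eq0 eqb0 negbK => /eqP; lia.
have s1 : s = 1%g.
  apply: homo_perm_id => i j ij.
  rewrite ltnNge; apply/negP => sji; have := partition_mono dz sji.
  have := partition_mono dz' (ltnW ij); rewrite !coordE.
  have := zs i; have := zs j; lia.
by case/eqP: zz'; apply/ffunP => i; have := zs i; rewrite s1 perm1 => /addIr.
Qed.

Lemma wfun0 k : @wfun R 0 k = (k == 0)%:R.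
Proof. by case: k => // -[|m] //=; rewrite bin_small. Qed.

Lemma vfun0 k : @vfun R 0 k = (k == 0)%:R.
Proof. by case: k => // -[|m]. Qed.

Lemma wfun_lt0 n k : k < 0 -> @wfun R n k = 0.
Proof. by case: k. Qed.

Lemma vfun_lt0 n k : k < 0 -> @vfun R n k = 0.
Proof. by case: k. Qed.

Lemma wfunS n k : @wfun R n.+1 k - wfun R n.+1 (k - 1) = wfun R n k.
Proof.
case: k => [[|m]|m].
- by rewrite /= !addn0 !bin0 subr0.
- have -> : Posz m.+1 - 1 = Posz m by lia.
  by rewrite /= addnS binS natrD addrK.
- have -> : Negz m - 1 = Negz m.+1 by lia.
  by rewrite /= subr0.
Qed.

Lemma vfunS n k : @vfun R n.+1 k = vfun R n k + vfun R n (k - 1).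
Proof.
case: k => [[|m]|m].
- by rewrite /= !bin0 addr0.
- have -> : Posz m.+1 - 1 = Posz m by lia.
  by rewrite /= binS natrD.
- have -> : Negz m - 1 = Negz m.+1 by lia.
  by rewrite /= addr0.
Qed.

Lemma wfun_sum n k m :
  \sum_(0 <= i < m) wfun R n (k + i%:Z) = wfun R n.+1 (k + m%:Z - 1) - wfun R n.+1 (k - 1).
Proof.
elim: m => [|m IH]; first by rewrite big_geq// addr0 subrr.
rewrite big_nat_recr//= IH -(wfunS n (k + _)) (_ : k + m.+1%:Z - 1 = k + m%:Z); last by lia.
by rewrite [LHS]addrC [LHS]addrA subrK.
Qed.

(* Subtracting from every row the next one: [w_(n.+1)] telescopes to sums of
   [w_n] over the integers between consecutive rows. *)
Lemma strip_det_wfunS n z z' : Wge0 z -> Wge0 z' ->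
  strip_det (@wfun R) n.+1 z z' =
  \sum_(f : {ffun 'I_N -> 'I_(`|coord z' 0|).+1} |
      [forall i : 'I_N, (f i)%:Z <= z' i - coord z' i.+1])
     strip_det (@wfun R) n z (vec_of (fun i => coord z' i.+1 + coord (fun k => (f k)%:Z) i)).
Proof.
move=> /Wge0E dz /Wge0E dz'.
pose L : 'M[R]_N := \matrix_(i, j) ((j == i)%:R - (j == i.+1 :> nat)%:R).
have detL : \det L = 1.
  rewrite -det_tr det_trig; last first.
    apply/is_trig_mxP => i j ij; rewrite !mxE.
    have -> : (i == j) = false by apply/negbTE; rewrite -val_eqE/=; lia.
    have -> : (i == j.+1 :> nat) = false by apply/negbTE; lia.
    by rewrite subrr.
  rewrite big1// => i _; rewrite !mxE eqxx.
  have -> : (i == i.+1 :> nat) = false by apply/negbTE; lia.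
  by rewrite subr0.
rewrite -[LHS]mul1r -detL -det_mulmx.
(* [t] is the offset above [coord z' i.+1]. Its type is a common finite range for all rows; the test
   cuts out the interval that belongs to row [i]. *)
pose F (i : 'I_N) (t : 'I_(`|coord z' 0|).+1) (j : 'I_N) : R :=
  if t%:Z <= z' i - coord z' i.+1
  then wfun R n (coord z' i.+1 + t%:Z - z j - (i : nat)%:Z + (j : nat)%:Z) else 0.
rewrite (_ : _ *m _ = \matrix_(i, j) \sum_t F i t j).
  rewrite det_sum_rows [RHS]big_mkcond; apply: eq_bigr => f _.
  case: ifPn => [/forallP fP|]; last first.
    rewrite negb_forall => /existsP[i /negbTE fi].
    by apply: (@det_row0 _ i) => j; rewrite mxE /F fi.
  congr (\det _); apply/matrixP => i j; rewrite !mxE /F fP ffunE coordE.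
  by [].
apply/matrixP => i j; rewrite !mxE.
transitivity (wfun R n.+1 (z' i - z j - (i : nat)%:Z + (j : nat)%:Z) -
    wfun R n.+1 (coord z' i.+1 - z j - (i.+1)%:Z + (j : nat)%:Z)).
  rewrite (eq_bigr (fun k : 'I_N => (k == i)%:R * wfun R n.+1 (z' k - z j - (k : nat)%:Z + (j : nat)%:Z)
     - (k == i.+1 :> nat)%:R * wfun R n.+1 (z' k - z j - (k : nat)%:Z + (j : nat)%:Z))); last first.
    by move=> k _; rewrite !mxE mulrBl.
  rewrite sumrB (bigD1 i)//= eqxx mul1r big1 ?addr0; last first.
    by move=> k /negbTE ->; rewrite mul0r.
  congr (_ - _); have [iN|iN] := ltnP i.+1 N.
    rewrite (bigD1 (Ordinal iN))//= eqxx mul1r big1 ?addr0; last first.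
      by move=> k; rewrite -val_eqE /= => /negbTE ->; rewrite mul0r.
    by rewrite -(coordE z' (Ordinal iN)).
  rewrite big1 => [|k _]; last first.
    have -> : (k == i.+1 :> nat) = false by apply/negbTE; have := ltn_ord k; lia.
    by rewrite mul0r.
  (* Nothing is subtracted from the last row, and the uniform formula still holds: with
     [coord z' i.+1 = 0] the argument of [wfun] is negative. *)
  rewrite coord_out//; have := partition_ge0 j dz; rewrite coordE => zj.
  by rewrite wfun_lt0//; have := ltn_ord j; lia.
have z'i := dz' i; rewrite coordE in z'i.
have z'0 := partition_mono dz' (leq0n i); rewrite coordE in z'0.
have z'iS := partition_ge0 i.+1 dz'.
rewrite /F -big_mkcond/= (eq_bigl (fun t : 'I__ => true && (t < `|z' i - coord z' i.+1|.+1)%N)); last first.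
  by move=> t; rewrite ltnS; lia.
rewrite -(big_mkord (fun t => true && (t < `|z' i - coord z' i.+1|.+1)%N)
   (fun t => wfun R n (coord z' i.+1 + t%:Z - z j - (i : nat)%:Z + (j : nat)%:Z))).
rewrite -big_nat_widen; last by lia.
rewrite (eq_bigr (fun t => wfun R n (coord z' i.+1 - z j - (i : nat)%:Z + (j : nat)%:Z + t%:Z))); last first.
  by move=> t _; congr (wfun R n _); lia.
by rewrite wfun_sum; congr (wfun R _ _ - wfun R _ _); lia.
Qed.

(** The box of offsets is in bijection with the partitions interlacing [z']. The nonnegativity
    assumption is discharged in [strip_det_ge0], by an induction that runs on this very identity. *)
Lemma strip_det_wfunS_esum n z z' : Wge0 z -> Wge0 z' ->
  (forall u, Wge0 u -> 0 <= strip_det (@wfun R) n z u) ->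
  (strip_det (@wfun R) n.+1 z z')%:E =
  \esum_(u in [set u | Wge0 u /\ interlace u z']) (strip_det (@wfun R) n z u)%:E.
Proof.
move=> Wz Wz' D0; rewrite strip_det_wfunS//.
set M := (`|coord z' 0|).+1.
pose e (f : {ffun 'I_N -> 'I_M}) : Zvec N :=
  vec_of (fun i => coord z' i.+1 + coord (fun k => (f k)%:Z) i).
have /Wge0E dz' := Wz'.
have eE (f : {ffun 'I_N -> 'I_M}) (i : 'I_N) : coord (e f) i = coord z' i.+1 + (f i)%:Z.
  by rewrite coord_vec ltn_ord coordE.
have img : [set e f | f in [set f : {ffun 'I_N -> 'I_M} |
      [forall i : 'I_N, (f i)%:Z <= z' i - coord z' i.+1]]] =
    [set u | Wge0 u /\ interlace u z'].
  apply/seteqP; split=> [_ [f /= /forallP fP <-]|u /= [/Wge0E du uz']].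
    have ez' : interlace (e f) z'.
      move=> i; have [iN|iN] := ltnP i N; last by rewrite !coord_out//; lia.
      have := fP (Ordinal iN); rewrite -(coordE z')/= (eE f (Ordinal iN)) /=; lia.
    split=> //; apply/Wge0E => i; have := ez' i; have := ez' i.+1; lia.
  have uM (i : 'I_N) : (`|(u i - coord z' i.+1)%R| < M)%N.
    have := uz' i; have := partition_mono dz' (leq0n i); have := dz' i.
    have := partition_ge0 i dz'; have := partition_ge0 i.+1 dz'; rewrite !coordE /M; lia.
  exists [ffun i => Ordinal (uM i)] => /=.
    apply/forallP => i; rewrite ffunE /=; have := uz' i; rewrite !coordE; lia.
  apply/ffunP => i; rewrite -(coordE (e _)) eE ffunE /=; have := uz' i; rewrite coordE; lia.
rewrite -img esum_finType//.
  move=> f g fg; apply/ffunP => i; apply/val_inj => /=.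
  by have := eE f i; rewrite fg eE => /addrI [].
move=> f Pf; apply: D0; have : [set u | Wge0 u /\ interlace u z'] (e f).
  by rewrite -img; exists f.
by case.
Qed.

Lemma strip_det_vfunS n z z' :
  strip_det (@vfun R) n.+1 z z' =
  \sum_(f : {ffun 'I_N -> bool})
     strip_det (@vfun R) n z [ffun i => z' i - (f i : nat)%:Z].
Proof.
rewrite /strip_det (_ : \matrix_(i, j) _ = \matrix_(i, j) \sum_(t : bool)
    vfun R n (z' i - (t : nat)%:Z - z j - (i : nat)%:Z + (j : nat)%:Z)); last first.
  apply/matrixP => i j; rewrite !mxE big_bool vfunS addrC.
  by congr (vfun R n _ + vfun R n _); rewrite /=; lia.
rewrite det_sum_rows; apply: eq_bigr => f _; congr (\det _).
by apply/matrixP => i j; rewrite !mxE ffunE.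
Qed.

(** Choices of bits that leave the partitions contribute zero: either [z'_k = z'_(k+1)] and only
    part [k] is lowered, so that rows [k] and [k+1] coincide, or the last part becomes [-1] and the
    last row has only negative arguments. *)
Lemma strip_det_vfunS_esum n z z' : Wge0 z -> Wge0 z' ->
  (forall u, Wge0 u -> 0 <= strip_det (@vfun R) n z u) ->
  (strip_det (@vfun R) n.+1 z z')%:E =
  \esum_(u in [set u | Wge0 u /\ vstrip u z']) (strip_det (@vfun R) n z u)%:E.
Proof.
move=> Wz Wz' D0; rewrite strip_det_vfunS.
pose e (f : {ffun 'I_N -> bool}) : Zvec N := [ffun i => z' i - (f i : nat)%:Z].
have eE (f : {ffun 'I_N -> bool}) (i : 'I_N) : coord (e f) i = z' i - (f i : nat)%:Z.
  by rewrite coordE ffunE.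
have /Wge0E dz' := Wz'; have /Wge0E dz := Wz.
pose ok (f : {ffun 'I_N -> bool}) := `[< Wge0 (e f) >].
rewrite (bigID ok)/= [X in _ + X]big1 ?addr0; last first.
  move=> f /asboolPn; rewrite -/(e f) => /Wge0E/existsNP[k /negP].
  rewrite -ltNge => fk; have [kN|kN] := ltnP k N; last first.
    by move: fk; rewrite !coord_out//; lia.
  have [kSN|kSN] := ltnP k.+1 N.
    move: fk; rewrite (eE f (Ordinal kN)) (eE f (Ordinal kSN)) -!(coordE z')/= => fk.
    apply: (determinant_alternate (i1 := Ordinal kN) (i2 := Ordinal kSN)).
      by rewrite -val_eqE/= neq_ltn ltnSn.
    move=> j; rewrite !mxE !ffunE -!(coordE z')/=; congr (vfun R n _).
    have := dz' k; move: fk; do 2 case: (f _) => /=; lia.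
  rewrite /strip_det; apply: (@det_row0 _ (Ordinal kN)) => j; rewrite !mxE vfun_lt0//.
  move: fk; rewrite [coord _ k.+1]coord_out// (eE f (Ordinal kN)) ffunE.
  have := partition_ge0 j dz; have := ltn_ord j; rewrite coordE /=; lia.
have img : [set e f | f in [set f | ok f]] = [set u | Wge0 u /\ vstrip u z'].
  apply/seteqP; split=> [_ [f /= /asboolP Wf <-]|u /= [Wu uz']].
    split=> // i; have [iN|iN] := ltnP i N; last by rewrite !coord_out.
    by rewrite (eE f (Ordinal iN)) -(coordE z')/=; case: (f _) => /=; lia.
  have eu : e [ffun i => z' i != u i] = u.
    apply/ffunP => i; rewrite !ffunE; have := uz' i; rewrite !coordE.
    by case: eqP => /=; lia.
  by exists [ffun i => z' i != u i] => //=; rewrite /ok eu; apply/asboolP.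
rewrite -img esum_finType//.
  move=> f g fg; apply/ffunP => i.
  by have := eE f i; rewrite fg eE => /addrI/oppr_inj[]; do 2 case: (_ i).
by move=> f /asboolP Wf; exact: D0.
Qed.

End Determinants.

(** * Semistandard tableaux as triangular arrays of counts *)

Section RowCounts.
Context {N : nat}.
Implicit Types (u v : seq 'I_N) (T U : seq (seq 'I_N)) (la mu : Zvec N).

(** Letters are numbered from [0], so the entries [< j] are the first [j] letters and [j] is the
    level in the pattern. *)
Definition count_below j u : nat := count (fun a : 'I_N => (a < j)%N) u.

Definition row T i : seq 'I_N := nth [::] T i.

Lemma count_below0 u : count_below 0 u = 0%N.
Proof. by rewrite /count_below (eq_count (a2 := pred0)) ?count_pred0. Qed.

Lemma count_below_size j u : (N <= j)%N -> count_below j u = size u.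
Proof.
move=> Nj; rewrite /count_below (eq_count (a2 := predT)) ?count_predT// => a.
exact: leq_trans (ltn_ord a) Nj.
Qed.

Lemma count_below_mono i j u : (i <= j)%N -> (count_below i u <= count_below j u)%N.
Proof. by move=> ij; apply: sub_count => a ai; exact: leq_trans ai ij. Qed.

Lemma count_below_le_size j u : (count_below j u <= size u)%N.
Proof. exact: count_size. Qed.

Lemma count_belowS (k : 'I_N) u :
  count_below k.+1 u = (count_below k u + count_mem k u)%N.
Proof.
rewrite /count_below -count_predUI [X in (_ + X)%N](eq_count (a2 := pred0)).
  rewrite count_pred0 addn0; apply: eq_count => a /=.
  by rewrite ltnS leq_eqVlt orbC -val_eqE.
by move=> a /=; apply/negbTE; rewrite negb_and -val_eqE /=; lia.
Qed.

Definition row_sorted u := sorted (fun a b : 'I_N => (a <= b)%N) u.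

(** In a weakly increasing row the entries [< j] form a prefix; comparisons of entries thereby
    become comparisons of counts. *)
Lemma nth_lt_count_below x0 j u m : row_sorted u -> (m < size u)%N ->
  (nth x0 u m < j)%N = (m < count_below j u)%N.
Proof.
rewrite /row_sorted; elim: u m => // a u IH m /= au mu.
have leT : transitive (fun b c : 'I_N => (b <= c)%N).
  by move=> b c d; exact: leq_trans.
case: m mu => [|m] mu /=.
  have [aj|ja] := ltnP a j; first by rewrite add1n.
  rewrite add0n; apply/esym/negbTE; rewrite -leqNgt leqn0.
  rewrite -leqn0 leqNgt -has_count; apply/hasPn => b bu.
  have /allP/(_ b bu) := order_path_min leT au; lia.
rewrite IH ?(path_sorted au)//; have [aj|ja] := ltnP a j; first by rewrite add1n.
rewrite add0n.
rewrite (_ : count_below j u = 0%N)//; apply/eqP.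
rewrite -leqn0 leqNgt -has_count; apply/hasPn => b bu.
have /allP/(_ b bu) := order_path_min leT au; lia.
Qed.

(** From left to right, look at the last entry of [v] that is [<= j]: the entry of [u] above it is
    [< j]. Conversely [j = N] compares the lengths, and taking for [j] the entry of [v] at position
    [m] gives strictness in column [m]. *)
Lemma fits_belowP u v : row_sorted u -> row_sorted v ->
  reflect (forall j, (count_below j.+1 v <= count_below j u)%N) (fits_below u v).
Proof.
move=> su sv; apply: (iffP andP) => [[vu /all_nthP uv] j|uv].
  have [->//|c_gt0] := posnP (count_below j.+1 v).
  have cv : ((count_below j.+1 v).-1 < size v)%N.
    by rewrite prednK// count_below_le_size.
  case: v => [//|x0 v] in sv vu uv c_gt0 cv *.
  have := uv (x0, x0) (count_below j.+1 (x0 :: v)).-1.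
  rewrite size_zip (minn_idPr vu) => /(_ cv).
  rewrite nth_zip_cond size_zip (minn_idPr vu) cv /= => lt_uv.
  have := nth_lt_count_below x0 j.+1 sv cv.
  rewrite prednK// leqnn ltnS => vj.
  have := nth_lt_count_below x0 j su (leq_trans cv vu).
  by rewrite (leq_trans lt_uv vj) prednK.
have vu : (size v <= size u)%N.
  by have := uv N; rewrite !count_below_size.
split=> //; case: v => [|x0 v] in sv vu uv *; first by case: (u).
apply/(all_nthP (x0, x0)) => m; rewrite size_zip (minn_idPr vu) => mv.
rewrite nth_zip_cond size_zip (minn_idPr vu) mv /=.
rewrite (nth_lt_count_below _ _ su (leq_trans mv vu)).
by apply: leq_trans (uv _); rewrite -(nth_lt_count_below x0 _ sv mv).
Qed.

(* Semistandardness in terms of the numbers of entries [< j] of each row: these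
   are the parts of a Gelfand-Tsetlin pattern, and the last condition is its
   interlacing property. *)
Lemma semistandardP T : semistandard T <->
  [/\ [::] \notin T, forall i, row_sorted (row T i) &
      forall i j, (count_below j.+1 (row T i.+1) <= count_below j (row T i))%N].
Proof.
rewrite /semistandard; split=> [/and3P[T0 /allP sT /(sortedP [::]) fT]|[T0 sT fT]].
  have sT' i : row_sorted (row T i).
    have [iT|iT] := ltnP i (size T); first by apply: sT; exact: mem_nth.
    by rewrite /row nth_default.
  split=> // i j; have [iT|iT] := ltnP i.+1 (size T).
    by have /fits_belowP := fT i iT; apply; exact: sT'.
  by rewrite /row [nth _ _ i.+1]nth_default.
rewrite T0 /=; apply/andP; split.
  by apply/(all_nthP [::]) => i _; exact: sT.
by apply/(sortedP [::]) => i iT; apply/fits_belowP => //; exact: sT.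
Qed.

Lemma count_below_row_eq0 T i j : semistandard T -> (j <= i)%N ->
  count_below j (row T i) = 0%N.
Proof.
move=> /semistandardP[_ _ iT]; elim: i j => [|i IH] [|j] ij; rewrite ?count_below0//.
by apply/eqP; rewrite -leqn0 (leq_trans (iT _ _))// IH.
Qed.

Lemma row_out T i : semistandard T -> (N <= i)%N -> row T i = [::].
Proof.
move=> sT Ni; apply/nilP; rewrite /nilp -(count_below_size _ (leqnn N)).
by rewrite count_below_row_eq0.
Qed.

Lemma size_row T i j : semistandard T -> (N <= j.+1)%N ->
  (size (row T i.+1) <= size (row T i))%N.
Proof.
move=> /semistandardP[_ _ iT] Nj; rewrite -(count_below_size (row _ i.+1) Nj).
exact: leq_trans (iT _ _) (count_below_le_size _ _).
Qed.

Lemma semistandard_size T : semistandard T -> (size T <= N)%N.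
Proof.
move=> sT; rewrite leqNgt; apply/negP => NT; have /semistandardP[T0 _ _] := sT.
by move/negP: T0; apply; rewrite -(row_out sT (leqnn N)) mem_nth.
Qed.

(** Counts determine the multiplicities and hence each sorted row; as no row is empty, they also
    determine the number of rows. *)
Lemma semistandard_ext T U : semistandard T -> semistandard U ->
  (forall i j, count_below j (row T i) = count_below j (row U i)) -> T = U.
Proof.
move=> sT sU TU.
have rTU i : row T i = row U i.
  have /semistandardP[_ /(_ i) rT _] := sT; have /semistandardP[_ /(_ i) rU _] := sU.
  apply: sorted_eq rT rU _.
  - by move=> b a c; exact: leq_trans.
  - by move=> a b; rewrite -eqn_leq => /eqP/val_inj.
  - apply/allP => a _; apply/eqP; apply/(@addnI (count_below a (row T i))).
    by rewrite -count_belowS TU TU -count_belowS.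
have nle T1 T2 : semistandard T1 -> semistandard T2 ->
    (forall i, row T1 i = row T2 i) -> (size T2 <= size T1)%N.
  move=> s1 s2 T12; rewrite leqNgt; apply/negP => lt12.
  have /semistandardP[T20 _ _] := s2; move/negP: T20; apply.
  by rewrite (_ : [::] = row T2 (size T1)) ?mem_nth// -T12 /row nth_default.
apply: (@eq_from_nth _ [::]) => [|i _]; last exact: rTU.
by apply/eqP; rewrite eqn_leq !nle// => i; rewrite rTU.
Qed.

(** Converse construction: row [i] contains [g a.+1 i - g a i] copies of each letter [a]. Only the
    levels [j <= N] can be realized, there being no further letters. *)
Lemma semistandard_exists (g : nat -> nat -> nat) :
  (forall i, g 0 i = 0)%N -> (forall j i, g j i <= g j.+1 i)%N ->
  (forall j i, g j.+1 i.+1 <= g j i)%N ->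
  exists2 T, semistandard T &
    forall i j, (j <= N)%N -> count_below j (row T i) = g j i.
Proof.
move=> g0 gmono ginter.
pose r i : seq 'I_N := sort (fun a b : 'I_N => (a <= b)%N)
  (flatten [seq nseq (g a.+1 i - g a i) a | a : 'I_N <- enum 'I_N]).
have gN0 i j : (j <= i)%N -> g j i = 0%N.
  elim: i j => [|i IH] [|j] ij; rewrite ?g0//.
  by apply/eqP; rewrite -leqn0 (leq_trans (ginter _ _))// IH.
have cr i j : (j <= N)%N -> count_below j (r i) = g j i.
  move=> jN; rewrite /count_below /r count_sort count_flatten sumnE 2!big_map big_enum/=.
  under eq_bigr do rewrite count_nseq.
  rewrite -(big_mkord xpredT (fun a => (a < j) * (g a.+1 i - g a i))%N).
  rewrite (big_cat_nat (n := j))//=.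
  have -> : (\sum_(j <= a < N) (a < j) * (g a.+1 i - g a i) = 0)%N.
    by rewrite big_nat_cond big1// => a /andP[/andP[ja _] _]; rewrite ltnNge ja.
  have -> : (\sum_(0 <= a < j) (a < j) * (g a.+1 i - g a i) =
      \sum_(0 <= a < j) (g a.+1 i - g a i))%N.
    by apply: eq_big_nat => a /= aj; rewrite aj mul1n.
  rewrite addn0 telescope_sumn ?g0 ?subn0// => a b ab.
  by rewrite -(subnK ab); elim: (b - a)%N => // m IH; exact: leq_trans IH (gmono _ _).
have r_nil i : (r i == [::]) = (g N i == 0%N).
  by rewrite -cr// count_below_size// size_eq0.
have rS i : r i = [::] -> r i.+1 = [::].
  move=> /eqP; rewrite r_nil => /eqP gi; apply/eqP; rewrite r_nil -leqn0 -gi.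
  exact: leq_trans (gmono _ _) (ginter _ _).
have rN i : (N <= i)%N -> r i = [::].
  by move=> Ni; apply/eqP; rewrite r_nil gN0.
(* Cutting at the first empty row loses nothing: by [rS] all later rows are empty as well. *)
pose s := mkseq r N; pose T := take (find (@nilp _) s) s.
have rT i : row T i = r i.
  rewrite /row /T; have [iF|Fi] := ltnP i (find (@nilp _) s).
    rewrite nth_take// nth_mkseq//; apply: leq_trans iF _.
    by rewrite -[X in (_ <= X)%N](size_mkseq r) find_size.
  rewrite nth_default ?size_take; last by case: ltnP => //; lia.
  have : r (find (@nilp _) s) = [::].
    have [sN|sN] := ltnP (find (@nilp _) s) N; last exact: rN.
    have hs : has (@nilp _) s by rewrite has_find size_mkseq.
    by apply/nilP; have := nth_find [::] hs; rewrite nth_mkseq.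
  by rewrite -(subnK Fi); elim: (_ - _)%N => // n IH rF; rewrite addSn rS// IH.
exists T; last by move=> i j jN; rewrite rT cr.
apply/semistandardP; split=> [|i|i j].
- apply/negP => /(nthP [::])[i iT]; have iF : (i < find (@nilp _) s)%N.
    by move: iT; rewrite /T size_take; case: ifP => // /negbT; lia.
  by rewrite /T nth_take// => iN; have := before_find [::] iF; rewrite iN.
- by rewrite rT; apply: sort_sorted => a b; exact: leq_total.
- rewrite !rT; have [jN|Nj] := ltnP j N; first by rewrite !cr// ltnW.
  rewrite !count_below_size// ?(leqW Nj)// -!(count_below_size _ (leqnn N)) !cr//.
  exact: leq_trans (gmono _ _) (ginter _ _).
Qed.

End RowCounts.

(** * Branching rule: sums over tableaux as iterated sums over interlacing rows *)

Section Branching.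
Context {R : realType} {N : nat}.
Implicit Types (T U : seq (seq 'I_N)) (la mu : Zvec N).

Definition shape_below j T : Zvec N := [ffun i : 'I_N => (count_below j (row T i))%:Z].

Lemma coord_shape_below j T i : semistandard T ->
  coord (shape_below j T) i = (count_below j (row T i))%:Z.
Proof.
move=> sT; have [iN|Ni] := ltnP i N.
  by rewrite -[i]/(nat_of_ord (Ordinal iN)) coordE ffunE.
by rewrite coord_out// row_out.
Qed.

Lemma sh_shape_below j T : (N <= j)%N -> sh T = shape_below j T.
Proof. by move=> Nj; apply/ffunP => i; rewrite !ffunE count_below_size. Qed.

Lemma coord_sh T i : semistandard T -> coord (sh T) i = (size (row T i))%:Z.
Proof.
by move=> sT; rewrite (sh_shape_below T (leqnn N)) coord_shape_below ?count_below_size.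
Qed.

Definition tableaux k la : set (seq (seq 'I_N)) :=
  [set T | [/\ semistandard T, forall i, count_below k (row T i) = size (row T i)
             & sh T = la]].

Lemma tableaux_below k T la : tableaux k la T -> shape_below k T = la.
Proof. by move=> [_ kT <-]; apply/ffunP => i; rewrite !ffunE kT. Qed.

Lemma count_below_stable k j T la i : tableaux k la T -> (k <= j)%N ->
  count_below j (row T i) = count_below k (row T i).
Proof.
move=> [_ kT _] kj; apply/eqP; rewrite eqn_leq (count_below_mono _ kj) andbT.
by rewrite kT count_below_le_size.
Qed.

Lemma tableauxN T : semistandard T -> tableaux N (sh T) T.
Proof. by move=> sT; split=> // i; rewrite count_below_size. Qed.

Lemma restrict_exists k T : semistandard T ->
  exists U, semistandard U /\
    forall i j, count_below j (row U i) = count_below (minn j k) (row T i).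
Proof.
move=> sT; have [||j i|U sU UP] := @semistandard_exists N
    (fun j i => count_below (minn j k) (row T i)).
- by move=> i; rewrite min0n count_below0.
- by move=> j i; apply: count_below_mono; lia.
- have [|kj] := ltnP j k.
    move=> jk; rewrite (minn_idPl jk).
    by case/semistandardP: sT.
  rewrite (minn_idPr (leqW kj)).
  case: k {kj} => [|k]; first by rewrite !count_below0.
  have /semistandardP[_ _ /(_ i k)] := sT; move/leq_trans; apply.
  exact: count_below_mono.
exists U; split=> // i j; have [jN|Nj] := leqP j N; first exact: UP.
rewrite count_below_size; last exact: ltnW.
rewrite -(count_below_size _ (leqnn N)) UP//.
have [kN|Nk] := leqP k N; first by congr count_below; lia.
by rewrite !count_below_size//; lia.
Qed.

(** Deletion of the letters [>= k], specified by counts instead of by filtering rows, since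
    filtering would leave empty rows to remove. The default [[::]] is not reached for semistandard
    [T]. *)
Definition restrict k T : seq (seq 'I_N) :=
  xget [::] [set U | semistandard U /\
    forall i j, count_below j (row U i) = count_below (minn j k) (row T i)].

Lemma restrictP k T : semistandard T -> semistandard (restrict k T) /\
  forall i j, count_below j (row (restrict k T) i) = count_below (minn j k) (row T i).
Proof.
move=> /(restrict_exists k) ex.
exact: (@xgetPex _ [::] [set U | semistandard U /\
  forall i j, count_below j (row U i) = count_below (minn j k) (row T i)]).
Qed.

Lemma shape_below_restrict k j T : semistandard T -> (j <= k)%N ->
  shape_below j (restrict k T) = shape_below j T.
Proof.
move=> sT jk; apply/ffunP => i; rewrite !ffunE.
by have [_ ->] := restrictP k sT; rewrite (minn_idPl jk).
Qed.

Lemma sh_restrict k T : semistandard T -> sh (restrict k T) = shape_below k T.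
Proof.
move=> sT; rewrite (sh_shape_below _ (leq_maxl N k)); apply/ffunP => i.
by rewrite !ffunE; have [_ ->] := restrictP k sT; rewrite (minn_idPr (leq_maxr N k)).
Qed.

(** The cells holding the largest letter [k] are those between the restricted shape and [la], so [T]
    is recovered from its restriction; interlacing is exactly what makes the refilled tableau
    semistandard. *)
Lemma restrict_bij k la : (k < N)%N ->
  set_bij (tableaux k.+1 la)
    [set U | tableaux k (sh U) U /\ interlace (sh U) la] (restrict k).
Proof.
move=> kN; split.
- move=> T [sT kT <-] /=; have [sU UT] := restrictP k sT.
  split.
    split=> // i; rewrite -(count_below_size _ (leqnn N)) !UT minnn.
    by rewrite (minn_idPr (ltnW kN)).
  move=> i; rewrite !coord_sh// -!(count_below_size _ (leqnn N)) !UT.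
  rewrite (minn_idPr (ltnW kN)) !lez_nat !(count_below_size _ (leqnn N)).
  rewrite count_below_le_size andbT -kT.
  by have /semistandardP[_ _ ->] := sT.
- move=> T U /set_mem TP /set_mem UP TU.
  have [sT kT shT] := TP; have [sU kU shU] := UP.
  apply: semistandard_ext => // i j; have [jk|kj] := leqP j k.
    have [_ /(_ i j)] := restrictP k sT; rewrite TU (restrictP k sU).2.
    by rewrite (minn_idPl jk).
  rewrite (count_below_stable _ TP)// (count_below_stable _ UP)// kT kU.
  by have := coord_sh i sT; rewrite shT -shU coord_sh// => -[].
move=> U [UP inter] /=; have [sU kU _] := UP.
have la0 i : 0 <= coord la i.
  by have := inter i; rewrite coord_sh//; lia.
have kUi i : (k <= i)%N -> size (row U i) = 0%N.
  by move=> ki; rewrite -kU count_below_row_eq0.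
(* The preimage keeps the counts of [U] up to level [k] and has shape [la] at all later levels. *)
have [|||T sT TP] := @semistandard_exists N (fun j i =>
    if (j <= k)%N then count_below j (row U i) else `|coord la i|%N).
- by move=> i; rewrite count_below0.
- move=> j i; have [jk|kj|->] := ltngtP j k.
  + exact: count_below_mono.
  + by [].
  + rewrite ?leqnn ?ltnn kU; have := inter i; rewrite coord_sh//; have := la0 i; lia.
- move=> j i; have [jk|kj|->] := ltngtP j k.
  + by case/semistandardP: sU.
  + have := inter i; have := la0 i.+1; lia.
  + rewrite ?leqnn ?ltnn kU; have := inter i; rewrite coord_sh//; have := la0 i.+1; lia.
have sizeT i : size (row T i) = `|coord la i|%N.
  by rewrite -(count_below_size _ (leqnn N)) TP// leqNgt kN.
have TT : tableaux k.+1 la T.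
  split=> //; first by move=> i; rewrite sizeT TP// ltnn.
  apply: coord_inj => i; rewrite coord_sh// sizeT; have := la0 i; lia.
exists T => //.
have [sV VT] := restrictP k sT.
apply: semistandard_ext => // i j; rewrite VT TP ?geq_minr; last by lia.
have [jk|kj] := leqP j k; first by rewrite ?leqnn ?jk.
by rewrite ?leqnn (count_below_stable _ UP (ltnW kj)).
Qed.

Definition vsum la : int := \sum_i la i.

(* A sum over Gelfand-Tsetlin patterns with [k] rows and top row [la]. *)
Fixpoint gt_sum (al : nat -> R) (h : nat -> Zvec N -> Zvec N -> R) k la : \bar R :=
  match k with
  | 0%N => (la == [ffun => 0])%:R%:E
  | k.+1 => \esum_(mu in [set mu | interlace mu la])
      ((al k ^ (vsum la - vsum mu) * h k la mu)%:E * gt_sum al h k mu)%E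
  end.

Lemma gt_sum_ge0 al h k la : (forall j, 0 <= al j) -> (forall j la mu, 0 <= h j la mu) ->
  (0 <= gt_sum al h k la)%E.
Proof.
move=> al0 h0; elim: k la => [|k IH] la /=; first by rewrite lee_fin ler0n.
apply: esum_ge0 => mu _; rewrite mule_ge0// lee_fin mulr_ge0//; exact: exprz_ge0.
Qed.

Definition level k la := partition_like la /\ forall i, (k <= i)%N -> coord la i = 0.

Lemma coord0 i : coord ([ffun => 0] : Zvec N) i = 0.
Proof.
have [iN|Ni] := ltnP i N; last exact: coord_out.
by rewrite -[i]/(nat_of_ord (Ordinal iN)) coordE ffunE.
Qed.

Lemma level0 la : level 0 la <-> la = [ffun => 0].
Proof.
split=> [[_ la0]|->]; first by apply: coord_inj => i; rewrite la0// coord0.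
by split=> [i|i _]; rewrite !coord0.
Qed.

Lemma levelS k mu la : level k mu -> interlace mu la -> level k.+1 la.
Proof.
move=> [dmu mu0] mula; split=> [i|[//|i] ki].
  have := mula i; have := mula i.+1; have := dmu i; lia.
have := mula i; have := mula i.+1; rewrite !mu0//; lia.
Qed.

(** A pattern starts from the zero row, and each interlacing step adds at most one nonzero part. *)
Lemma gt_sum_level al h k la : ~ level k la -> gt_sum al h k la = 0%E.
Proof.
elim: k la => [|k IH] la /=.
  by case: eqP => // ->; case; apply/level0.
move=> nla; apply: esum1 => mu /= mula; rewrite IH ?mule0// => kmu.
exact: nla (levelS kmu mula).
Qed.

Definition pattern_weight al (h : nat -> Zvec N -> Zvec N -> R) k T : R :=
  \prod_(0 <= j < k) (al j ^ (vsum (shape_below j.+1 T) - vsum (shape_below j T)) *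
                      h j (shape_below j.+1 T) (shape_below j T)).

Lemma pattern_weight_ge0 al h k T : (forall j, 0 <= al j) ->
  (forall j la mu, 0 <= h j la mu) -> 0 <= pattern_weight al h k T.
Proof.
by move=> al0 h0; apply: prodr_ge0 => j _; rewrite mulr_ge0 ?exprz_ge0.
Qed.

(** Induction on [k], removing the largest letter with [restrict_bij]; the sum over [mu] and over
    tableaux of shape [mu] merges because [mu] is the shape of the tableau. *)
Lemma gt_sum_tableaux al h k la : (forall j, 0 <= al j) ->
  (forall j la mu, 0 <= h j la mu) -> (k <= N)%N ->
  gt_sum al h k la = \esum_(T in tableaux k la) (pattern_weight al h k T)%:E.
Proof.
move=> al0 h0; elim: k la => [|k IH] la kN.
  transitivity (\esum_(T in tableaux 0 la) 1%E : \bar R); last first.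
    by apply: eq_esum => T _; rewrite /pattern_weight big_geq.
  have nilT T mu : tableaux 0 mu T -> T = [::].
    move=> [sT T0 _]; have /semistandardP[nT _ _] := sT.
    case: T nT {sT} T0 => // r T; rewrite inE negb_or => /andP[+ _] /(_ 0%N) /=.
    by rewrite /row /= count_below0 => + /esym/size0nil r0; rewrite r0.
  rewrite /=; case: eqP => [->|la0].
    rewrite (_ : tableaux 0 _ = [set [::]]) ?esum_set1//.
    apply/seteqP; split=> [T /nilT//|_ ->]; split=> //.
      by move=> i; rewrite /row nth_nil count_below0.
    by apply/ffunP => i; rewrite !ffunE nth_nil.
  rewrite (_ : tableaux 0 la = set0) ?esum_set0//.
  apply/seteqP; split=> // T TP; apply: la0; have := nilT _ _ TP.
  by case: TP => _ _ <- ->; apply/ffunP => i; rewrite !ffunE nth_nil.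
rewrite /=; pose c mu := al k ^ (vsum la - vsum mu) * h k la mu.
have c0 mu : 0 <= c mu by rewrite mulr_ge0 ?exprz_ge0.
transitivity (\esum_(mu in [set mu | interlace mu la]) \esum_(U in tableaux k mu)
    (c (sh U) * pattern_weight al h k U)%:E)%E.
  apply: eq_esum => mu mula; rewrite IH; last exact: ltnW.
  rewrite -esumZl//; last 2 first.
  - by rewrite lee_fin; exact: c0.
  - by move=> T; rewrite lee_fin pattern_weight_ge0.
  by apply: eq_esum => U [_ _ ->]; rewrite -EFinM.
transitivity (\esum_(U in [set U | tableaux k (sh U) U /\ interlace (sh U) la])
    (c (sh U) * pattern_weight al h k U)%:E)%E.
  rewrite [RHS](@esum_fiber _ _ _ _ [set mu | interlace mu la] (@sh N))//.
  - apply: eq_esum => mu mula; congr esum; apply/seteqP; split=> U.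
      by move=> [sU kU shU] /=; rewrite /= shU.
    by move=> /= [[[sU kU _] _] <-].
  - by move=> U; rewrite lee_fin mulr_ge0// pattern_weight_ge0.
  - by move=> U [].
rewrite (@reindex_esum _ _ _ _ _ _ _ (restrict_bij la kN)); apply: eq_esum => T TP.
have [sT kT shT] := TP.
rewrite sh_restrict// [in RHS]/pattern_weight big_nat_recr//= mulrC.
rewrite -/(shape_below k.+1 T) (tableaux_below TP); congr ((_ * _)%:E).
apply: eq_big_nat => j /andP[_ jk].
by rewrite !shape_below_restrict// ltnW.
Qed.

End Branching.

(** * Local identities for Cases A and C: weight-preserving bijections *)

Section LocalIdentities.
Context {R : realType} {N : nat}.
Implicit Types (la mu : Zvec N).

Definition update (g : update_rule) k (a b c : int) (x : nat) : int :=
  if k is 0%N then a + x%:Z else g a b c x%:Z.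

(* Fixed: the old row [la] of level [k.+1] and the new row [mu'] of level [k].
   Left: the old row [mu] and the increment [x]; right: the new row [la'].
   For [k = 0] the values at [edge k.-1] are ignored by [update]. *)
Definition local_identity (g : update_rule) (X : set nat)
    (strip : Zvec N -> Zvec N -> Prop) (edge : nat -> nat) (al : R) :=
  forall k la mu', (k < N)%N -> level k.+1 la -> level k mu' -> forall b : int,
  (\esum_(mu in [set mu | interlace mu la /\ strip mu mu'])
    \esum_(x in [set x | X x /\ update g k (coord la (edge k))
          (coord mu (edge k.-1)) (coord mu' (edge k.-1)) x = b])
      (al ^ (vsum la - vsum mu + x%:Z))%:E =
  \esum_(la' in [set la' | [/\ interlace mu' la', strip la la' & coord la' (edge k) = b]])
    (al ^ (vsum la' - vsum mu'))%:E)%E.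

Lemma vsumE la : vsum la = \sum_(0 <= i < N) coord la i.
Proof. by rewrite big_mkord; apply: eq_bigr => i _; rewrite coordE. Qed.

Lemma sum_shift (f : nat -> int) n :
  \sum_(0 <= i < n) f i.+1 = \sum_(0 <= i < n) f i - f 0%N + f n.
Proof.
elim: n => [|n IH]; first by rewrite !big_geq// sub0r addNr.
by rewrite !big_nat_recr//= IH; ring.
Qed.

Lemma coord_vec_id (f : nat -> int) : (forall i, (N <= i)%N -> f i = 0) ->
  coord (vec_of f : Zvec N) =1 f.
Proof. by move=> f0 i; rewrite coord_vec; case: ltnP => // /f0. Qed.

Section Reflection.
Variables (la mu' : Zvec N).

(* For fixed [la] and [mu'], the parts [mu_i] and [la'_(i+1)] range independently
   over the same interval, which this map reverses. *)
Definition reflect_part (nu : nat -> int) i : int :=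
  Num.max (coord la i.+1) (coord mu' i.+1) + Num.min (coord la i) (coord mu' i) -
  nu i.

Lemma sum_reflect_part nu : coord la N = 0 -> coord mu' N = 0 ->
  \sum_(0 <= i < N) reflect_part nu i =
  vsum la + vsum mu' - Num.max (coord la 0) (coord mu' 0) - \sum_(0 <= i < N) nu i.
Proof.
move=> laN muN; rewrite /reflect_part sumrB big_split/=; congr (_ - _).
rewrite (sum_shift (fun i => Num.max (coord la i) (coord mu' i))) laN muN maxxx addr0.
rewrite addrAC -big_split/= !vsumE -big_split/=; congr (_ - _).
by apply: eq_bigr => i _; lia.
Qed.
End Reflection.

(** The tail of [la'] is reflected to [mu], and [x] is the excess of the first part of [la'] over
    [max (la_0, mu'_0)]. Exponents agree because the sums of the interval ends telescope, by
    [sum_reflect_part], to [|la| + |mu'| - max (la_0, mu'_0)]. *)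
Lemma ruleA_local_identity (al : R) : 0 < al ->
  local_identity ruleA setT (@interlace N) (fun=> 0%N) al.
Proof.
move=> al0 k la mu' kN [dla la0] [dmu mu0] b.
have N0 : (0 < N)%N by exact: leq_trans kN.
rewrite esum_esum; last by move=> *; rewrite lee_fin exprz_ge0// ltW.
pose m la' := reflect_part la mu' (fun i => coord la' i.+1).
have m_out la' : interlace mu' la' -> coord (vec_of (m la') : Zvec N) =1 m la'.
  move=> mula'; apply: coord_vec_id => i Ni; rewrite /m /reflect_part.
  by rewrite !coord_out//; lia.
have upd la1 (x : nat) mu : (update ruleA k (coord la1 0) (coord mu 0) (coord mu' 0) x) =
    if k is 0 then coord la1 0 + x%:Z else Num.max (coord la1 0) (coord mu' 0) + x%:Z.
  by case: (k).
(* At [k = 0] the rule has no maximum, but [mu'] is the zero row and [la_0 >= 0], so the same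
   formula holds. *)
have updE (x : nat) mu : update ruleA k (coord la 0) (coord mu 0) (coord mu' 0) x =
    Num.max (coord la 0) (coord mu' 0) + x%:Z.
  rewrite upd; case: k kN la0 mu0 {upd} => // kN la0 mu0.
  by have := partition_ge0 0 dla; rewrite mu0//; lia.
have weightE (la' : Zvec N) : interlace mu' la' -> interlace la la' ->
    vsum la - vsum (vec_of (m la') : Zvec N) +
      `|coord la' 0 - Num.max (coord la 0) (coord mu' 0)|%N%:Z = vsum la' - vsum mu'.
  move=> mula' lala'; have out l : coord (l : Zvec N) N = 0 by exact: coord_out.
  rewrite (vsumE (vec_of (m la'))); under eq_bigr do rewrite m_out//.
  rewrite (sum_reflect_part _ (out _) (out _)) (sum_shift (coord la')) -vsumE out.
  have := mula' 0%N; have := lala' 0%N; lia.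
rewrite (@reindex_esum _ _ _ [set la' | [/\ interlace mu' la', interlace la la' & coord la' 0 = b]]
   _ (fun la' => (vec_of (m la') : Zvec N, `|coord la' 0 - Num.max (coord la 0) (coord mu' 0)|%N))).
  by apply: eq_esum => la' [mula' lala' lab] /=; rewrite weightE.
split.
- move=> la' [mula' lala' lab] /=; split; first split.
  + move=> i; rewrite m_out// /m /reflect_part; have := mula' i; have := lala' i.
    have := mula' i.+1; have := lala' i.+1; lia.
  + move=> i; rewrite !m_out// /m /reflect_part; have := mula' i; have := lala' i.
    have := mula' i.+1; have := lala' i.+1; lia.
  + split=> //; rewrite updE; have := mula' 0%N; have := lala' 0%N; lia.
- move=> l1 l2 /set_mem[i1 s1 b1] /set_mem[i2 s2 b2] /= [m12 _].
  apply: coord_inj => -[|i]; first by rewrite b1 b2.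
  have : m l1 i = m l2 i by rewrite -m_out// m12 m_out.
  by rewrite /m /reflect_part => /addrI/oppr_inj.
move=> [mu x] /= [[mula mumu'] [_ +]]; rewrite updE => bE.
(* Reflection is an involution, so [mu] is reflected back into the tail; the edge condition forces
   the first part to be [b]. *)
pose l i := if i is i'.+1 then reflect_part la mu' (coord mu) i' else b.
have lE : coord (vec_of l : Zvec N) =1 l.
  apply: coord_vec_id => -[|i] Ni; first by lia.
  have := mula i; have := mumu' i; have := mumu' i.+1; rewrite /= /reflect_part.
  rewrite ![coord _ i.+1]coord_out//; have [iN|Ni'] := ltnP i N; last by rewrite ![coord _ i]coord_out//; lia.
  by rewrite (mu0 i); lia.
exists (vec_of l).
  split; last by rewrite lE.
    move=> [|i]; rewrite !lE /= /reflect_part; have := mula 0%N; have := mumu' 0%N.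
      by have := mula 1%N; have := mumu' 1%N; lia.
    by have := mula i; have := mumu' i; have := mula i.+1; have := mumu' i.+1; lia.
  move=> [|i]; rewrite !lE /= /reflect_part; have := mula 0%N; have := mumu' 0%N.
    by have := mula 1%N; have := mumu' 1%N; lia.
  by have := mula i; have := mumu' i; have := mula i.+1; have := mumu' i.+1; lia.
congr pair; last by rewrite lE /=; lia.
apply: coord_inj => i; rewrite coord_vec; case: ltnP => iN; last by rewrite coord_out.
rewrite /m /reflect_part lE /= /reflect_part; lia.
Qed.

(** For fixed edge [b], the pairs with [min (la_(k+1) + x, mu_k) = b] form a path: [mu_k] runs down
    from its maximum to [b] while [x = b - la_(k+1)], then [x] grows while [mu_k = b]. Every move
    raises the exponent by one, as does raising the first part of [la'], so positions on the path
    match values of that part. All other parts are reflected as in Case A. *)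
Lemma ruleC_local_identity (al : R) : 0 < al ->
  local_identity ruleC setT (@interlace N) id al.
Proof.
(* At [k = 0] the first coordinate has the same update in all cases, and both edges are part [0]. *)
move=> al0 [|k] la mu' kN lla lmu b; first exact: (ruleA_local_identity al0 kN lla lmu).
have [dla la0] := lla; have [dmu mu0] := lmu.
rewrite esum_esum; last by move=> *; rewrite lee_fin exprz_ge0// ltW.
(* [la'_(k+1) = min (la_(k+1) + x, mu_k)] keeps part of the pair [(mu_k, x)]; the
   rest is the distance from [mu_k] to its maximum [M] plus the part of [x]
   blocked by [mu_k], and it is added to the first part of [la']. *)
pose M := Num.min (coord la k) (coord mu' k).
pose excess (la' : Zvec N) : int := coord la' 0 - Num.max (coord la 0) (coord mu' 0).
pose r (la' : Zvec N) := reflect_part la mu' (fun i => coord la' i.+1).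
pose m (la' : Zvec N) i :=
  if i == k then Num.max (M - excess la') (coord la' k.+1) else r la' i.
pose x_ (la' : Zvec N) : int :=
  coord la' k.+1 - coord la k.+1 + Num.max (excess la' - (M - coord la' k.+1)) 0.
pose e (la' : Zvec N) := (vec_of (m la') : Zvec N, `|x_ la'|%N).
have m_out la' : interlace mu' la' -> coord (vec_of (m la') : Zvec N) =1 m la'.
  move=> mula'; apply: coord_vec_id => i Ni; rewrite /m /r /reflect_part.
  have -> : (i == k) = false by apply/negbTE; lia.
  by rewrite !coord_out//; lia.
have weightE (la' : Zvec N) : interlace mu' la' -> interlace la la' ->
    vsum la - vsum (vec_of (m la') : Zvec N) + `|x_ la'|%N%:Z = vsum la' - vsum mu'.
  move=> mula' lala'; have out l : coord (l : Zvec N) N = 0 by exact: coord_out.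
  have -> : vsum (vec_of (m la') : Zvec N) = \sum_(0 <= i < N) r la' i + (m la' k - r la' k).
    rewrite vsumE; under eq_bigr do rewrite m_out//.
    rewrite !big_mkord.
    have kN' : (k < N)%N by lia.
    rewrite (bigD1 (Ordinal kN'))//= [in RHS](bigD1 (Ordinal kN'))//=.
    rewrite (eq_bigr (fun i : 'I_N => r la' i)); first lia.
    by move=> i; rewrite -val_eqE /= /m => /negbTE ->.
  rewrite (sum_reflect_part _ (out _) (out _)) (sum_shift (coord la')) -vsumE out.
  rewrite /m eqxx /r /reflect_part /x_ /excess /M (mu0 k.+1)//.
  have := mula' 0%N; have := lala' 0%N; have := lala' k.+1.
  have := lala' k; have := mula' k; have := partition_ge0 k.+1 dla; lia.
rewrite (@reindex_esum _ _ _
  [set la' | [/\ interlace mu' la', interlace la la' & coord la' k.+1 = b]] _ e).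
  by apply: eq_esum => la' [mula' lala' lab] /=; rewrite weightE.
split.
- move=> la' [mula' lala' lab] /=; split; first split.
  + move=> i; rewrite m_out// /m /r /excess /reflect_part.
    have := mula' i; have := lala' i; have := mula' i.+1; have := lala' i.+1.
    have := mula' 0%N; have := lala' 0%N.
    case: eqP => [->|_]; rewrite /M; lia.
  + move=> i; rewrite !m_out// /m /r /excess /reflect_part.
    have := mula' i; have := lala' i; have := mula' i.+1; have := lala' i.+1.
    have := mula' 0%N; have := lala' 0%N.
    case: eqP => [->|_]; rewrite /M; lia.
  + split=> //; rewrite /ruleC m_out// /m eqxx /x_ /excess /M.
    have := mula' k; have := lala' k; have := mula' k.+1; have := lala' k.+1.
    have := mula' 0%N; have := lala' 0%N; lia.
- move=> l1 l2 /set_mem[i1 s1 b1] /set_mem[i2 s2 b2] [m12 /eqP x12].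
  have mE i : m l1 i = m l2 i by rewrite -m_out// m12 m_out.
  apply: coord_inj => -[|i].
    move: (mE k) x12; rewrite /m /x_ /excess eqxx b1 b2.
    have := i1 0%N; have := s1 0%N; have := i2 0%N; have := s2 0%N.
    have := i1 k; have := s1 k; have := s1 k.+1; have := i2 k; have := s2 k.
    rewrite /M; lia.
  have := mE i; rewrite /m /r /reflect_part; case: eqP => [->|_ /addrI/oppr_inj//].
  by rewrite b1 b2.
move=> [mu x] /= [[mula mumu'] [_ bE]]; rewrite /ruleC in bE.
pose l i := if i is i'.+1 then (if i' == k then b else reflect_part la mu' (coord mu) i')
  else Num.max (coord la 0) (coord mu' 0) + (M - coord mu k) +
       (coord la k.+1 + x%:Z - b).
have lE : coord (vec_of l : Zvec N) =1 l.
  apply: coord_vec_id => -[|i] Ni; first by lia.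
  rewrite /= (_ : i == k = false); last by apply/eqP; lia.
  have := mula i; have := mumu' i; have := mumu' i.+1; rewrite /= /reflect_part.
  rewrite ![coord _ i.+1]coord_out//; have [iN|Ni'] := ltnP i N.
    by rewrite (mu0 i); lia.
  by rewrite ![coord _ i]coord_out//; lia.
have inter_l (v : Zvec N) : v = la \/ v = mu' -> interlace v (vec_of l).
  move=> vE [|i]; rewrite !lE /= /reflect_part /M.
    have := mula 0%N; have := mumu' 0%N; have := mula 1%N; have := mumu' 1%N.
    have := mula k; have := mumu' k; have := mula k.+1; have := mumu' k.+1.
    by case: vE => ->; case: eqP bE => [<-|_]; lia.
  have := mula i; have := mumu' i; have := mula i.+1; have := mumu' i.+1.
  have := mu0 k.+1; have := mu0 k.+2; have := la0 k.+2.
  by case: vE => ->; (case: (i =P k) bE => [<-|ik];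
    [case: (i.+1 =P i)|case: (i.+1 =P k) => [<-|ik']]); lia.
exists (vec_of l).
  split; [by apply: inter_l; right|by apply: inter_l; left|by rewrite lE /= eqxx].
have := mula k; have := mumu' k; have := mula k.+1; have := mumu' k.+1 => h1 h2 h3 h4.
congr pair; last first.
  by rewrite /x_ /excess !lE /= eqxx; lia.
apply: coord_inj => i; rewrite coord_vec; case: ltnP => iN; last by rewrite coord_out.
rewrite /m /r /excess /reflect_part !lE /= eqxx /reflect_part.
by case: eqP => [->|_]; lia.
Qed.

End LocalIdentities.

(** * Local identities for Cases B and D: telescoping products *)

Section BernoulliIdentities.
Context {R : realType} {N : nat}.
Implicit Types (la mu : Zvec N).
Variable al : R.
Hypothesis al_gt0 : 0 < al.

Lemma sum_bits (c : 'I_N -> bool -> bool) :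
  \sum_(f : {ffun 'I_N -> bool} | [forall i, c i (f i)]) al ^+ (\sum_i (f i : nat)) =
  \prod_i \sum_(t : bool | c i t) al ^+ t.
Proof.
rewrite [LHS]big_mkcond (eq_bigr (fun i => \sum_(t : bool) if c i t then al ^+ t else 0));
  last by move=> i _; rewrite big_mkcond.
rewrite (bigA_distr_bigA (fun i (t : bool) => if c i t then al ^+ t else 0)).
apply: eq_bigr => f _; case: ifPn => [/forallP cf|].
  by rewrite -prodrXr; apply: eq_bigr => i _; rewrite cf.
by rewrite negb_forall => /existsP[i /negbTE ci]; rewrite (bigD1 i)//= ci mul0r.
Qed.

(** Common form of both sides: old rows are [mu'] lowered by bits ([sg = -1]), new rows are [la]
    raised by bits ([sg = 1]). The constraints concern one bit each, so the sum factors over the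
    parts. *)
Lemma esum_bits (v : Zvec N) (sg : int) (c : 'I_N -> bool -> bool)
    (A : set (Zvec N)) (w : Zvec N -> int) (w0 : int) :
  sg != 0 ->
  (forall u, A u <-> exists2 f : {ffun 'I_N -> bool}, (forall i, c i (f i)) &
     u = [ffun i => v i + sg * (f i : nat)%:Z]) ->
  (forall f : {ffun 'I_N -> bool},
     w [ffun i => v i + sg * (f i : nat)%:Z] = w0 + \sum_i (f i : nat)%:Z) ->
  (\esum_(u in A) (al ^ w u)%:E =
   (al ^ w0 * \prod_i \sum_(t : bool | c i t) al ^+ t)%:E)%E.
Proof.
move=> sg0 AP wP.
pose e (f : {ffun 'I_N -> bool}) : Zvec N := [ffun i => v i + sg * (f i : nat)%:Z].
rewrite (_ : A = [set e f | f in [set f : {ffun 'I_N -> bool} | [forall i, c i (f i)]]]).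
  rewrite esum_finType.
  - congr EFin; rewrite -sum_bits mulr_sumr; apply: eq_bigr => f _.
    rewrite wP expfzDr ?gt_eqF//; congr (_ * _); rewrite exprnP; congr (al ^ _).
    by rewrite (big_morph Posz PoszD (erefl (Posz 0))).
  - move=> f g /ffunP fg; apply/ffunP => i; have := fg i; rewrite !ffunE.
    by move=> /addrI/(mulfI sg0) []; do 2 case: (_ i).
  - by move=> f _; rewrite exprz_ge0// ltW.
apply/seteqP; split=> u; first by move=> /AP[f fP ->]; exists f => //=; apply/forallP.
by move=> [f /= /forallP fP <-]; apply/AP; exists f.
Qed.

Section Telescoping.
Variables (L M : nat -> int).
Hypothesis L_part : forall i, L i.+1 <= L i.
Hypothesis M_part : forall i, M i.+1 <= M i.

(** With [L = la] and [M = mu'], this is the factor of part [i] in the sum over old rows; [up_sum]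
    is its counterpart for new rows, with no condition on the edge. *)
Definition down_sum i : R :=
  (if L i.+1 <= M i - 1 <= L i then al else 0) + (if L i.+1 <= M i <= L i then 1 else 0).

Definition up_ok i (f : int) : bool :=
  (M i <= L i + f) && (if i is i'.+1 then L i + f <= M i' else true).

Definition up_sum i : R := (if up_ok i 1 then al else 0) + (if up_ok i 0 then 1 else 0).

Hypothesis LM : forall i, L i.+1 <= M i <= L i + 1.

(* If [M i = L i.+1], then part [i] of the lower row is frozen on the left-hand
   side, while on the right-hand side it is part [i.+1] of the upper row. *)
Definition touch i : R := if M i == L i.+1 then 1 + al else 1.

(** The induction step is the one-part identity [down_sum j.+1 * touch j.+1 = touch j * up_sum
    j.+1], checked by cases. *)
Lemma prod_down_up j :
  (\prod_(0 <= i < j.+1) down_sum i) * touch j = \prod_(0 <= i < j.+1) up_sum i.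
Proof.
elim: j => [|j IH].
  rewrite !big_nat1 /down_sum /up_sum /touch /up_ok.
  have := LM 0; have := L_part 0; have := M_part 0.
  by do 5 case: ifP => ?; move=> ? ? ?; first [lia|ring].
rewrite big_nat_recr//= [RHS]big_nat_recr//= -IH -!mulrA; congr (_ * _).
rewrite /down_sum /up_sum /touch /up_ok.
have := LM j; have := LM j.+1; have := L_part j; have := M_part j.
have := L_part j.+1; have := M_part j.+1.
by do 6 case: ifP => ?; move=> ? ? ? ? ? ?; first [lia|ring].
Qed.
End Telescoping.

Definition up_sum_at (L M : nat -> int) (t : nat) (b : int) i : R :=
  (if up_ok L M i 1 && ((i == t) ==> (L i + 1 == b)) then al else 0) +
  (if up_ok L M i 0 && ((i == t) ==> (L i + 0 == b)) then 1 else 0).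

Lemma vsum_bits (v : Zvec N) sg (f : {ffun 'I_N -> bool}) :
  vsum [ffun i => v i + sg * (f i : nat)%:Z] = vsum v + sg * \sum_i (f i : nat)%:Z.
Proof.
rewrite /vsum mulr_sumr -big_split/=; apply: eq_bigr => i _; by rewrite ffunE.
Qed.

Lemma coord_bits (v : Zvec N) sg (f : {ffun 'I_N -> bool}) i (iN : (i < N)%N) :
  coord [ffun i => v i + sg * (f i : nat)%:Z] i =
  coord v i + sg * (f (Ordinal iN) : nat)%:Z.
Proof. by rewrite -[i]/(nat_of_ord (Ordinal iN)) !coordE ffunE. Qed.

Lemma vstrip_down la mu' : (\esum_(mu in [set mu | interlace mu la /\ vstrip mu mu'])
    (al ^ (vsum la - vsum mu))%:E =
  (al ^ (vsum la - vsum mu') *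
   \prod_(0 <= i < N) down_sum (coord la) (coord mu') i)%:E)%E.
Proof.
rewrite (@esum_bits mu' (-1) (fun i t =>
   coord la i.+1 <= coord mu' i - (t : nat)%:Z <= coord la i) _ _ (vsum la - vsum mu'))//.
- rewrite big_mkord; congr ((_ * _)%:E); apply: eq_bigr => i _.
  by rewrite big_mkcond big_bool /= subr0 expr1 expr0.
- move=> u; split=> [[ula umu]|[f fP ->]].
    exists [ffun i => mu' i != u i] => [i|].
      have := ula i; have := umu i; rewrite ffunE !coordE.
      by case: eqP => /=; lia.
    apply/ffunP => i; rewrite !ffunE; have := umu i; rewrite !coordE.
    by case: eqP => /=; lia.
  split=> i.
    have [iN|Ni] := ltnP i N; last by rewrite !coord_out//; lia.
    by have := fP (Ordinal iN); rewrite coord_bits /=; lia.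
  have [iN|Ni] := ltnP i N; last by rewrite !coord_out.
  by rewrite coord_bits; case: (f _) => /=; lia.
- by move=> f; rewrite vsum_bits; lia.
Qed.

Lemma vstrip_up la mu' t b : partition_like mu' -> (t < N)%N ->
  (\esum_(la' in [set la' | [/\ interlace mu' la', vstrip la la' & coord la' t = b]])
    (al ^ (vsum la' - vsum mu'))%:E =
  (al ^ (vsum la - vsum mu') *
   \prod_(0 <= i < N) up_sum_at (coord la) (coord mu') t b i)%:E)%E.
Proof.
move=> dmu tN.
rewrite (@esum_bits la 1 (fun i f => up_ok (coord la) (coord mu') i (f : nat)%:Z &&
   ((i == t :> nat) ==> (coord la i + (f : nat)%:Z == b))) _ _ (vsum la - vsum mu'))//.
- rewrite big_mkord; congr ((_ * _)%:E); apply: eq_bigr => i _.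
  by rewrite big_mkcond big_bool /= expr1 expr0.
- move=> u; split=> [[ula umu ut]|[f fP ->]].
    exists [ffun i => la i != u i] => [i|].
      rewrite ffunE /up_ok; have := ula i; have := umu i; case: i => -[|i] iN /=;
        rewrite -(coordE la) -(coordE u)/=; last have := ula i.
        by case: (coord la 0 =P _) => ?; case: (0%N =P t) ut => [<-|_] /=; lia.
      by case: (coord la i.+1 =P _) => ?; case: (i.+1 =P t) ut => [<-|_] /=; lia.
    apply/ffunP => i; rewrite !ffunE; have := umu i; rewrite !coordE.
    by case: eqP => /=; lia.
  split=> [i|i|].
  + have [iN|Ni] := ltnP i N; last by rewrite !coord_out//; lia.
    have [iN1|Ni1] := ltnP i.+1 N.
      have := fP (Ordinal iN); have := fP (Ordinal iN1).
      by rewrite /up_ok !coord_bits /=; lia.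
    rewrite [coord _ i.+1]coord_out// coord_bits; have := partition_ge0 i dmu.
    by have := fP (Ordinal iN); rewrite /up_ok /=; lia.
  + have [iN|Ni] := ltnP i N; last by rewrite !coord_out.
    by rewrite coord_bits; case: (f _) => /=; lia.
  + by have := fP (Ordinal tN); rewrite eqxx /= coord_bits mul1r => /andP[_ /eqP].
- by move=> f; rewrite vsum_bits; lia.
Qed.

Lemma down_sum_eq0 (L M : nat -> int) i : (forall i, L i.+1 <= L i) ->
  ~~ (L i.+1 <= M i <= L i + 1) -> down_sum L M i = 0.
Proof.
move=> dL; have := dL i; rewrite /down_sum.
by do 2 case: ifP => ?; move=> ? ?; first [lia|rewrite addr0].
Qed.

(** Together with [down_sum_eq0]: if the bounds [LM] fail at [i], both sides of the local identity
    vanish. On this side factor [i.+1] or factor [i] is zero, according to which bound fails. *)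
Lemma prod_up_sum_at0 la mu' t b i : partition_like mu' -> partition_like la ->
  ~~ (coord la i.+1 <= coord mu' i <= coord la i + 1) ->
  \prod_(0 <= i < N) up_sum_at (coord la) (coord mu') t b i = 0.
Proof.
move=> dmu dla; have mui := partition_ge0 i dmu; have lai := partition_ge0 i dla.
rewrite negb_and => /orP[lamu|mula].
  have iN : (i.+1 < N)%N.
    by rewrite ltnNge; apply/negP => Ni; move: lamu; rewrite coord_out//; lia.
  rewrite (bigD1_seq i.+1) ?mem_index_iota ?iota_uniq//= /up_sum_at /up_ok.
  rewrite [X in X + _](_ : _ = 0) ?add0r; last by case: ifP => // ?; lia.
  by rewrite [X in X * _](_ : _ = 0) ?mul0r//; case: ifP => // ?; lia.
have iN : (i < N)%N.
  rewrite ltnNge; apply/negP => Ni; move: mula.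
  by rewrite (coord_out mu' Ni) (coord_out la Ni).
rewrite (bigD1_seq i) ?mem_index_iota ?iota_uniq//= /up_sum_at /up_ok.
rewrite [X in X + _](_ : _ = 0) ?add0r; last by case: ifP => // ?; lia.
by rewrite [X in X * _](_ : _ = 0) ?mul0r//; case: ifP => // ?; lia.
Qed.

Lemma esum_bernoulli (u : int -> int) b :
  (\esum_(x in [set x : nat | (x <= 1)%N /\ u x%:Z = b]) (al ^ x%:Z)%:E =
   ((if u 1 == b then al else 0) + (if u 0 == b then 1 else 0))%:E)%E.
Proof.
rewrite (_ : [set x | _] = [set (t : nat) | t in [set t : bool | u (t : nat)%:Z == b]]).
  rewrite esum_finType; [|by case; case|by move=> t _; rewrite exprz_ge0// ltW].
  by rewrite big_mkcond big_bool /= expr1z expr0z.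
apply/seteqP; split=> [x [x1 /eqP ub]|_ [t /= /eqP tb <-]]; last by case: t tb.
by exists (x == 1%N) => /=; case: x x1 ub => [|[|]].
Qed.

(** Rules B and D read the new value of the neighbour only, so the updated edge [u] does not depend
    on the old row [mu], and the double sum over [mu] and [x] is a product. *)
Lemma bernoulli_local_identity g (edge : nat -> nat) (u : nat -> Zvec N -> Zvec N -> int -> int) :
  (forall k la mu mu' x, update g k (coord la (edge k)) (coord mu (edge k.-1))
      (coord mu' (edge k.-1)) x = u k la mu' x%:Z) ->
  (forall k, (edge k <= k)%N) ->
  (forall k la mu' b, (k < N)%N -> level k.+1 la -> level k mu' ->
    (forall i, coord la i.+1 <= coord mu' i <= coord la i + 1) ->
    (\prod_(0 <= i < N) down_sum (coord la) (coord mu') i) *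
      ((if u k la mu' 1 == b then al else 0) + (if u k la mu' 0 == b then 1 else 0)) =
    \prod_(0 <= i < N) up_sum_at (coord la) (coord mu') (edge k) b i) ->
  local_identity g [set x | (x <= 1)%N] (@vstrip N) edge al.
Proof.
move=> uE edge_le prodE k la mu' kN lla lmu b.
have [dla la0] := lla; have [dmu mu0] := lmu.
transitivity (\esum_(mu in [set mu | interlace mu la /\ vstrip mu mu'])
   ((al ^ (vsum la - vsum mu))%:E *
   \esum_(x in [set x : nat | (x <= 1)%N /\ u k la mu' x%:Z = b]) (al ^ x%:Z)%:E))%E.
  apply: eq_esum => mu _; rewrite -esumZl; last 2 first.
  - by rewrite lee_fin exprz_ge0// ltW.
  - by move=> x; rewrite lee_fin exprz_ge0// ltW.
  rewrite (_ : [set x | _] = [set x : nat | (x <= 1)%N /\ u k la mu' x%:Z = b]).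
    by apply: eq_esum => x _; rewrite -EFinM -expfzDr ?gt_eqF.
  apply/seteqP; split=> x [x1 <-]; (split; first exact: x1).
    exact/esym/uE.
  exact: uE.
rewrite esumZr; last 2 first.
- by apply: esum_ge0 => x _; rewrite lee_fin exprz_ge0// ltW.
- by move=> mu; rewrite lee_fin exprz_ge0// ltW.
rewrite esum_bernoulli vstrip_down vstrip_up//; last exact: leq_ltn_trans (edge_le k) kN.
rewrite -EFinM -mulrA; congr ((_ * _)%:E).
have [LM|/existsNP[i /negP bad]] :=
  pselect (forall i, coord la i.+1 <= coord mu' i <= coord la i + 1).
  exact: prodE.
rewrite (prod_up_sum_at0 _ _ dmu dla bad).
have iN : (i < N)%N.
  rewrite ltnNge; apply/negP => Ni; move: bad.
  by rewrite (coord_out mu' Ni) (coord_out la Ni) coord_out//; lia.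
rewrite (bigD1_seq i) ?mem_index_iota ?iota_uniq//=.
by rewrite (down_sum_eq0 _ bad)// !mul0r.
Qed.

(** Only factor [0] carries the edge condition. After multiplication by the nonzero numbers [1 + al]
    and [up_sum L M 0], the claim is [prod_down_up] combined with the one-part identity [XE]. *)
Lemma ruleD_local_identity :
  local_identity ruleD [set x | (x <= 1)%N] (@vstrip N) (fun=> 0%N) al.
Proof.
pose u k (la mu' : Zvec N) (x : int) : int :=
  if k is 0%N then coord la 0 + x else Num.max (coord la 0 + x) (coord mu' 0).
apply: (@bernoulli_local_identity _ _ u) => [[]//|//|k la mu' b kN lla lmu LM].
have [dla la0] := lla; have [dmu mu0] := lmu.
set L := coord la; set M := coord mu'.
have uE x : 0 <= x -> u k la mu' x = Num.max (L 0%N + x) (M 0%N).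
  move=> x0; rewrite /u /M /L; case: (k) mu0 => // -> //.
  by have := partition_ge0 0 dla; lia.
rewrite !uE//; set X := (X in _ * X = _).
have N0 : (0 < N)%N by exact: leq_trans kN.
(* The telescoping runs over all [N] parts and ends at [M N.-1 = 0 = L N], since [mu'] has at most
   [k < N] nonzero parts. *)
have touchN : touch L M N.-1 = 1 + al.
  rewrite /touch /M mu0; last by lia.
  by rewrite prednK// /L coord_out// eqxx.
have := prod_down_up dla dmu LM N.-1.
rewrite prednK// touchN => downE.
pose V := \prod_(1 <= i < N) up_sum L M i.
have upE : \prod_(0 <= i < N) up_sum L M i = up_sum L M 0 * V by rewrite big_ltn.
have -> : \prod_(0 <= i < N) up_sum_at L M 0 b i = up_sum_at L M 0 b 0 * V.
  rewrite big_ltn//; congr (_ * _); apply: eq_big_nat => -[//|i] _.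
  by rewrite /up_sum_at /= !andbT.
have al1 : 1 + al != 0 by rewrite gt_eqF// addr_gt0.
have V0 : up_sum L M 0 != 0.
  rewrite /up_sum /up_ok; have := LM 0%N; rewrite -/L -/M; have := dla 0%N.
  do 2 case: ifP => ?; move=> _ ?; try lia.
  - by rewrite addrC.
  - by rewrite addr0 gt_eqF.
apply: (mulIf al1); apply: (mulIf V0).
have XE : X * up_sum L M 0 = up_sum_at L M 0 b 0 * (1 + al).
  rewrite /X /up_sum /up_sum_at /up_ok /=; have := LM 0%N; rewrite -/L -/M.
  by do ?(case: ifP => ? /=); move=> ?; first [lia|ring].
rewrite -/L -/M upE in downE.
clear upE al1 V0; clearbody V X; move: XE downE; move: (\prod_(0 <= i < N) _) (up_sum _ _ 0) (up_sum_at _ _ _ _ 0).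
move=> D v v' XE DE; transitivity (D * (1 + al) * (X * v)); first by ring.
by rewrite DE XE; ring.
Qed.

(** From index [k] on, the level bounds freeze every part except the edge of [la']. The earlier
    factors telescope and leave one [touch]: it accounts for [mu'_(k-1) = la_k], where the minimum
    blocks the increment and both values of [x] give the same edge. *)
Lemma ruleB_local_identity :
  local_identity ruleB [set x | (x <= 1)%N] (@vstrip N) id al.
Proof.
pose u k (la mu' : Zvec N) (x : int) : int :=
  if k is k'.+1 then Num.min (coord la k + x) (coord mu' k') else coord la 0 + x.
apply: (@bernoulli_local_identity _ _ u) => [[]//|//|k la mu' b kN lla lmu LM].
have [dla la0] := lla; have [dmu mu0] := lmu.
set L := coord la; set M := coord mu'.
have Lge0 i : 0 <= L i by exact: partition_ge0.
rewrite (big_cat_nat (n := k))//=; last exact: ltnW.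
rewrite [RHS](big_cat_nat (n := k))//=; last exact: ltnW.
have -> : \prod_(k <= i < N) down_sum L M i = 1.
  rewrite big_nat_cond big1// => i /andP[/andP[ki _] _].
  have Mi : M i = 0 by exact: mu0.
  have Li : L i.+1 = 0 by exact: la0.
  by rewrite /down_sum Mi Li lexx Lge0 /= add0r.
have -> : \prod_(k <= i < N) up_sum_at L M k b i = up_sum_at L M k b k.
  rewrite big_ltn// big_nat_cond big1 ?mulr1// => -[//|i] /andP[/andP[ki _] _].
  rewrite /up_sum_at /up_ok /M /L !mu0// ?la0//; last lia.
  by rewrite (_ : (i.+1 == k) = false) ?andbT /= ?add0r//; lia.
have -> : \prod_(0 <= i < k) up_sum_at L M k b i = \prod_(0 <= i < k) up_sum L M i.
  apply: eq_big_nat => i /andP[_ ik].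
  by rewrite /up_sum_at (_ : (i == k) = false) ?andbT//; lia.
rewrite mulr1; case: k => [|k] in kN lla lmu la0 mu0 *.
  rewrite !big_geq// !mul1r /u /up_sum_at /up_ok /= {2 4}/L {1 2}/M !mu0//.
  have := Lge0 0%N.
  by do ?(case: ifP => ? /=); move=> ?; first [lia|ring].
rewrite -(prod_down_up dla dmu LM) -mulrA; congr (_ * _).
rewrite /u /touch /up_sum_at /up_ok eqxx /=; have := LM k; rewrite -/L -/M.
have := Lge0 k.+1; have : M k.+1 = 0 by rewrite /M mu0.
by do ?(case: ifP => ? /=); move=> ? ? ?; first [lia|ring].
Qed.

End BernoulliIdentities.

(** * One step of the chain, by induction on the levels of the pattern *)

Section OneStep.
Context {R : realType} {N : nat}.
Implicit Types (la mu y : Zvec N).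
Variables (al q : nat -> R) (g : update_rule) (X : set nat).
Variables (strip : Zvec N -> Zvec N -> Prop) (edge : nat -> nat).
Variable r : nat -> int -> int -> int -> int -> R.
Hypothesis al_gt0 : forall k, 0 < al k.
Hypothesis q_ge0 : forall k, 0 <= q k.
Hypothesis rE : forall k a b c d, (k < N)%N ->
  (r k a b c d)%:E =
  (\esum_(x in [set x | X x /\ update g k a b c x = d]) (q k * al k ^+ x)%:E)%E.
Hypothesis r_ge0 : forall k a b c d, 0 <= r k a b c d.
Hypothesis strip_le : forall mu la i, strip mu la -> coord mu i <= coord la i.
Hypothesis strip00 : strip [ffun => 0] [ffun => 0].
Hypothesis localP : forall k, local_identity g X strip edge (al k).

(** As level factors of [gt_sum], [edge_is y] selects the patterns with edge [y], and [edge_step y]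
    weights a pattern by the probability that its edge moves to [y]. *)
Definition edge_is y k la mu : R := (coord la (edge k) == coord y k)%:R.

Definition edge_step y k la mu : R :=
  r k (coord la (edge k)) (coord mu (edge k.-1)) (coord y k.-1) (coord y k).

Lemma edge_is_ge0 y k la mu : 0 <= edge_is y k la mu.
Proof. exact: ler0n. Qed.

Lemma edge_step_ge0 y k la mu : 0 <= edge_step y k la mu.
Proof. exact: r_ge0. Qed.

Let al_ge0 k : 0 <= al k. Proof. exact: ltW. Qed.

Let gt_is_ge0 y k la : (0 <= gt_sum al (edge_is y) k la)%E.
Proof. by apply: gt_sum_ge0 => // *; exact: edge_is_ge0. Qed.

Lemma gt_sum_edge_is y k la : gt_sum al (edge_is y) k.+1 la != 0%E ->
  coord la (edge k) = coord y k.
Proof.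
move=> /eqP nz; apply/eqP; apply/negPn/negP => /negbTE ne; apply: nz.
by apply: esum1 => mu _; rewrite /edge_is ne mulr0 mul0e.
Qed.

(** A nonzero sum below [mu'] means that [mu'] has level [k] and, for [k > 0], that its edge is
    [y_(k-1)]; this allows the new neighbour in the rule to be replaced by the edge of [mu'], as the
    local identity requires. *)
Lemma esum_step y k la mu' : (k < N)%N -> level k.+1 la ->
  gt_sum al (edge_is y) k mu' != 0%E ->
  (\esum_(mu in [set mu | interlace mu la /\ strip mu mu'])
    (al k ^ (vsum la - vsum mu) * edge_step y k la mu)%:E =
  (q k)%:E * \esum_(la' in [set la' | [/\ interlace mu' la', strip la la' &
      coord la' (edge k) = coord y k]]) (al k ^ (vsum la' - vsum mu'))%:E)%E.
Proof.
move=> kN lla nz.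
have lmu : level k mu'.
  by apply: contrapT => nl; move/eqP: nz; apply; exact: gt_sum_level.
have <- := @localP k k la mu' kN lla lmu (coord y k); rewrite -esumZl ?lee_fin//; last first.
  by move=> mu; apply: esum_ge0 => x _; rewrite lee_fin exprz_ge0.
apply: eq_esum => mu _; rewrite -esumZl ?lee_fin//; last first.
  by move=> x; rewrite lee_fin exprz_ge0.
rewrite EFinM /edge_step rE// -esumZl; last 2 first.
- by rewrite lee_fin exprz_ge0.
- by move=> x; rewrite lee_fin mulr_ge0// exprn_ge0.
have -> : [set x | X x /\ update g k (coord la (edge k)) (coord mu (edge k.-1))
      (coord y k.-1) x = coord y k] =
    [set x | X x /\ update g k (coord la (edge k)) (coord mu (edge k.-1))
      (coord mu' (edge k.-1)) x = coord y k].
  case: k kN nz {lla lmu} => [//|k] kN nz.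
  by rewrite [k.+1.-1]/= (gt_sum_edge_is nz).
apply: eq_esum => x _; rewrite -!EFinM; congr (_%:E).
by rewrite [in RHS]expfzDr ?lt0r_neq0// mulrCA.
Qed.

Lemma gt_sum_step0 y k la : partition_like la -> ~ level k la ->
  (\esum_(la' in [set la' | strip la la']) gt_sum al (edge_is y) k la' = 0)%E.
Proof.
move=> dla nla; apply: esum1 => la' /= s; apply: gt_sum_level => -[dla' la'0].
apply: nla; split=> // i ki; have := strip_le i s; rewrite la'0// => lai.
by apply/eqP; rewrite eq_le lai partition_ge0.
Qed.

(** The induction hypothesis replaces what lies below [mu] by new rows [mu']. Exchanging the sums
    fixes [la] and [mu'], where [esum_step] trades [mu] for [la']; a second exchange reassembles the
    new pattern under [la']. *)
Lemma gt_sum_step y k la : (k <= N)%N -> partition_like la ->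
  (gt_sum al (edge_step y) k la = (\prod_(0 <= j < k) q j)%:E *
   \esum_(la' in [set la' | strip la la']) gt_sum al (edge_is y) k la')%E.
Proof.
elim: k la => [|k IH] la kN dla.
  have [lla|nla] := pselect (level 0 la); last first.
    by rewrite gt_sum_level// gt_sum_step0// mule0.
  rewrite big_geq// mul1e; move/level0: lla => ->.
  rewrite (@esum_if0 _ _ _ [set [ffun => 0]]) ?esum_set1 /= ?eqxx//.
    by move=> _ ->.
  by move=> la' _ /eqP/negbTE ->.
have [lla|nla] := pselect (level k.+1 la); last first.
  by rewrite gt_sum_level// gt_sum_step0// mule0.
rewrite [LHS]/=.
transitivity (\esum_(mu in [set mu | interlace mu la])
    \esum_(mu' in [set mu' | strip mu mu'])
      ((\prod_(0 <= j < k) q j)%:E *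
       ((al k ^ (vsum la - vsum mu) * edge_step y k la mu)%:E *
        gt_sum al (edge_is y) k mu')))%E.
  apply: eq_esum => mu mula; rewrite IH; last 2 first.
  - exact: ltnW.
  - by move=> i; have := mula i; have := mula i.+1; have := dla i; lia.
  rewrite esumZl; last 2 first.
  - by rewrite lee_fin prodr_ge0.
  - by move=> mu'; rewrite mule_ge0// lee_fin mulr_ge0 ?exprz_ge0 ?edge_step_ge0.
  rewrite esumZl//; last by rewrite lee_fin mulr_ge0 ?exprz_ge0 ?edge_step_ge0.
  by rewrite muleCA.
rewrite (@esum_exchange _ _ _ _ _ setT
  (fun mu' => [set mu | interlace mu la /\ strip mu mu'])); last 2 first.
- move=> mu mu'; rewrite mule_ge0 ?lee_fin ?prodr_ge0// mule_ge0// lee_fin.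
  by rewrite mulr_ge0 ?exprz_ge0 ?edge_step_ge0.
- by move=> mu mu' /=; tauto.
transitivity ((\prod_(0 <= j < k.+1) q j)%:E * \esum_(mu' in [set: Zvec N])
    \esum_(la' in [set la' | [/\ interlace mu' la', strip la la' &
      coord la' (edge k) = coord y k]])
      ((al k ^ (vsum la' - vsum mu') * edge_is y k la' mu')%:E * gt_sum al (edge_is y) k mu'))%E.
  rewrite -esumZl; last 2 first.
  - by rewrite lee_fin prodr_ge0.
  - move=> mu'; apply: esum_ge0 => la' _.
    by rewrite mule_ge0// lee_fin mulr_ge0 ?exprz_ge0 ?edge_is_ge0.
  apply: eq_esum => mu' _.
  have [z|nz] := eqVneq (gt_sum al (edge_is y) k mu') 0%E.
    by rewrite !esum1 ?mule0// => *; rewrite z !mule0.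
  rewrite esumZl; last 2 first.
  - by rewrite lee_fin prodr_ge0.
  - by move=> mu; rewrite mule_ge0// lee_fin mulr_ge0 ?exprz_ge0 ?edge_step_ge0.
  rewrite !esumZr//; last 2 first.
  - by move=> mu; rewrite lee_fin mulr_ge0 ?exprz_ge0 ?edge_is_ge0.
  - by move=> mu; rewrite lee_fin mulr_ge0 ?exprz_ge0 ?edge_step_ge0.
  rewrite esum_step// big_nat_recr//= EFinM -!muleA; congr (_ * (_ * (_ * _)))%E.
  by apply: eq_esum => la' [_ _ e]; rewrite /edge_is e eqxx mulr1.
congr (_ * _)%E.
rewrite (@esum_exchange _ _ _ _ _ [set la' | strip la la' /\ coord la' (edge k) = coord y k]
  (fun la' => [set mu' | interlace mu' la'])); last 2 first.
- by move=> mu' la'; rewrite mule_ge0// lee_fin mulr_ge0 ?exprz_ge0 ?edge_is_ge0.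
- by move=> mu' la' /=; split=> [[_ []]|[[]]].
rewrite [RHS](@esum_if0 _ _ _ [set la' | strip la la' /\ coord la' (edge k) = coord y k])//.
  by move=> la' [].
move=> la' /= s ne; apply: esum1 => mu' _; rewrite /edge_is.
by case: eqP => [e|_]; [case: ne|rewrite mulr0 mul0e].
Qed.

End OneStep.

(** * Countable additivity in terms of [esum] *)

Section Countable.
Context {R : realType} {d : measure_display} {Omega : measurableType d}.
Variable P : probability Omega R.

Lemma probability_fin (A : set Omega) : measurable A -> P A \is a fin_num.
Proof. by move=> mA; exact: fin_num_measure. Qed.

Lemma measure_countable_bigcup (T : countType) (F : T -> set Omega) :
  (forall t, measurable (F t)) -> trivIset setT F ->
  P (\bigcup_t F t) = (\esum_(t in [set: T]) P (F t))%E.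
Proof.
move=> mF tF; pose G n : set Omega := if pickle_inv n is Some t then F t else set0.
have GE t : G (choice.pickle t) = F t by rewrite /G pickleK_inv.
rewrite (_ : \bigcup_t F t = \bigcup_(n in range (@choice.pickle T)) G n); last first.
  apply/seteqP; split=> w; first by move=> [t _ Ft]; exists (choice.pickle t) => //; rewrite GE.
  by move=> [_ [t _ <-]]; rewrite GE => Ft; exists t.
rewrite measure_bigcup => [|_ [t _ <-]|]; last 2 first.
- by rewrite GE.
- move=> _ _ [s _ <-] [t _ <-]; rewrite !GE => w.
  by congr choice.pickle; apply: tF w.
rewrite nneseries_esum => [|n _]; last exact: measure_ge0.
rewrite set_mem_set esum_image; last first.
  by move=> s t _ _ /(pcan_inj pickleK_inv).
by apply: eq_esum => t _; rewrite GE.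
Qed.

Lemma measure_nat_preimage (X : Omega -> nat) (B : set nat) :
  (forall r, measurable [set w | X w = r]) ->
  P (X @^-1` B) = (\esum_(x in B) P [set w | X w = x])%E.
Proof.
move=> mX; rewrite (_ : _ @^-1` _ = \bigcup_(x in B) [set w | X w = x]).
  rewrite measure_bigcup//.
    rewrite nneseries_esum ?set_mem_set// => n _; exact: measure_ge0.
  by move=> x y _ _ [w [/= <- <-]].
apply/seteqP; split=> w /=; first by move=> Bx; exists (X w).
by move=> [x Bx /= ->].
Qed.
End Countable.

(** * The Markov property of the chain *)

Section Markov.
Context {R : realType} {d : measure_display} {Omega : measurableType d}.
Context {P : probability Omega R} {N : nat}.
Variables (xi : 'I_N -> nat -> {RV P >-> nat}) (g : update_rule).
Hypothesis hxi : independent_noise xi.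
Variable r : nat -> int -> int -> int -> int -> R.
Hypothesis rP : forall (k : 'I_N) m a b c e, (1 <= m)%N ->
  P (xi k m @^-1` [set x | update g k a b c x = e]) = (r k a b c e)%:E.
Implicit Types (y : Zvec N) (B : nat -> 'I_N -> set nat).

Let noise : 'I_N -> nat -> Omega -> nat := fun k m => xi k m.

Definition transition y y' : R :=
  \prod_(k < N) r k (coord y k) (coord y k.-1) (coord y' k.-1) (coord y' k).

Definition row_event y y' (k : 'I_N) : set nat :=
  [set x | update g k (coord y k) (coord y k.-1) (coord y' k.-1) x = coord y' k].

Lemma step_event y y' (x : 'I_N -> nat) :
  step g y (fun k => (x k)%:Z) = y' <-> forall k, row_event y y' k (x k).
Proof.
have xE (k : 'I_N) : coord (fun k => (x k)%:Z) k = (x k)%:Z by rewrite coordE.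
split=> [<- k|yy'].
  rewrite /row_event /=; case: k => -[|k] kN /=.
    by rewrite -[0%N]/(nat_of_ord (Ordinal kN)) [RHS]coordE ffunE /= -(xE (Ordinal kN)).
  have kN' : (k < N)%N by exact: ltnW.
  rewrite -[k.+1 in RHS]/(nat_of_ord (Ordinal kN)) [RHS]coordE ffunE /= -(xE (Ordinal kN)).
  congr g; rewrite -[k in LHS]/(nat_of_ord (Ordinal kN')) coordE ffunE //.
apply: coord_inj => k; have [kN|Nk] := ltnP k N; last by rewrite !coord_out.
have E m : (m < N)%N -> step_coord g (coord y) (coord (fun k => (x k)%:Z)) m = coord y' m.
  elim: m => [|m IH] mN; have := yy' (Ordinal mN); rewrite /row_event /= -(xE (Ordinal mN)) //.
  by rewrite IH// ltnW.
by rewrite -[k in LHS]/(nat_of_ord (Ordinal kN)) coordE ffunE E.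
Qed.

Definition future n M B : set Omega :=
  [set w | forall m k, (n < m <= M)%N -> B m k (xi k m w)].

Definition index_box n M : {fset 'I_N * nat} :=
  [fset km in [seq (k, m) | m <- index_iota n.+1 M.+1, k <- enum 'I_N]]%fset.

Lemma mem_index_box n M km : (km \in index_box n M) = (n < km.2 <= M)%N.
Proof.
rewrite in_fset /=; apply/allpairsP/idP => [[[m k] /= [+ _ ->]]|kmP].
  by rewrite mem_index_iota.
exists (km.2, km.1); split; rewrite ?mem_enum ?mem_index_iota//.
by case: km {kmP}.
Qed.

Lemma futureE n M B : future n M B =
  \bigcap_(km in [set` index_box n M]) (xi km.1 km.2 @^-1` B km.2 km.1).
Proof.
apply/seteqP; split=> w /= wB; first by move=> km /=; rewrite mem_index_box => /wB.
by move=> m k mP; apply: (wB (k, m)); rewrite /= mem_index_box.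
Qed.

Lemma measurable_preimage k m (B : set nat) : measurable (xi k m @^-1` B).
Proof. by apply: measurable_funPTI. Qed.

Lemma measurable_future n M B : measurable (future n M B).
Proof.
rewrite futureE; apply: fin_bigcap_measurable; first exact: finite_fset.
by move=> *; exact: measurable_preimage.
Qed.

Definition row_prob m B : R := \prod_(k < N) fine (P (xi k m @^-1` B m k)).

Lemma future_prob M B : P (future 0 M B) = (\prod_(1 <= m < M.+1) row_prob m B)%:E.
Proof.
rewrite futureE hxi; last 2 first.
- by move=> km /=; rewrite mem_index_box => /andP[].
- by [].
congr (_%:E); rewrite /row_prob.
rewrite [RHS](eq_bigr (fun m => \prod_(k <- enum 'I_N) fine (P (xi k m @^-1` B m k)))); last first.
  by move=> m _; rewrite big_enum.
rewrite -(big_allpairs_dep (I2 := fun=> 'I_N) (h := fun m k => (k, m)) (r1 := index_iota 1 M.+1)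
   (r2 := fun=> enum 'I_N) (F := fun km => fine (P (xi km.1 km.2 @^-1` B km.2 km.1)))).
apply: perm_big; apply: uniq_perm; first exact: fset_uniq.
  apply: allpairs_uniq; [exact: iota_uniq|exact: enum_uniq|].
  by move=> [m k] [m' k'] _ _ /= [-> ->].
by move=> km; rewrite in_fset.
Qed.

Lemma chainS_event n y y'' :
  [set w | chain g noise y n.+1 w = y''] =
  \bigcup_y' ([set w | chain g noise y n w = y'] `&`
              [set w | forall k, row_event y' y'' k (xi k n.+1 w)]).
Proof.
apply/seteqP; split=> w /=.
  by move=> /step_event wP; exists (chain g noise y n w).
by move=> [y' _ [/= -> wP]]; apply/step_event.
Qed.

Lemma row_future n y y' : [set w | forall k, row_event y y' k (xi k n.+1 w)] =
  future n n.+1 (fun=> row_event y y').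
Proof.
apply/seteqP; split=> w /= wP; first by move=> m k /andP[nm mn]; rewrite (_ : m = n.+1)//; lia.
by move=> k; apply: wP; rewrite !ltnSn/=.
Qed.

(** Independence of the state at time [n] from the later noise, tested on finite boxes only, as
    these are what [independent_noise] evaluates. Measurability is part of the induction because
    additivity needs it. *)
Definition markov_at n y := forall y' M B, (n <= M)%N ->
  measurable [set w | chain g noise y n w = y'] /\
  P ([set w | chain g noise y n w = y'] `&` future n M B) =
  (fine (P [set w | chain g noise y n w = y']) * \prod_(n.+1 <= m < M.+1) row_prob m B)%:E.

Lemma measurable_chainS n y y' : markov_at n y ->
  measurable [set w | chain g noise y n.+1 w = y'].
Proof.
move=> IH; rewrite chainS_event; apply: countable_bigcupT_measurable => [|y1].
  exact: countableP.
apply: measurableI; first by have [] := IH y1 n (fun _ _ => setT) (leqnn n).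
rewrite row_future; exact: measurable_future.
Qed.

Lemma chain_future_step n y y' M B : markov_at n y -> (n < M)%N ->
  P ([set w | chain g noise y n.+1 w = y'] `&` future n.+1 M B) =
   ((\esum_(y1 in [set: Zvec N])
      (fine (P [set w | chain g noise y n w = y1]) * transition y1 y')%:E) *
    (\prod_(n.+2 <= m < M.+1) row_prob m B)%:E)%E.
Proof.
move=> IH nM.
have mchain y1 : measurable [set w | chain g noise y n w = y1].
  by have [] := IH y1 n (fun _ _ => setT) (leqnn n).
have row_probE y1 B' : (forall k, B' n.+1 k = row_event y1 y' k) ->
    row_prob n.+1 B' = transition y1 y'.
  by move=> B'E; apply: eq_bigr => k _; rewrite B'E rP.
(* Given the state [y1] at time [n], the step to [y'] is a condition on the noise at time [n.+1]
   alone, so it becomes one more layer of the box and the hypothesis at time [n] applies. *)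
pose B1 y1 m := if m == n.+1 then row_event y1 y' else B m.
rewrite chainS_event setI_bigcupl (eq_bigcupr (G := fun y1 =>
    [set w | chain g noise y n w = y1] `&` future n M (B1 y1))); last first.
  move=> y1 _; rewrite -setIA; congr (_ `&` _); apply/seteqP; split=> w /=.
    move=> [w1 w2] m k nm; rewrite /B1; case: eqP => [->//|nm'].
    by apply: w2; lia.
  move=> wP; split=> [k|m k nm].
    by have := wP n.+1 k; rewrite /B1 eqxx; apply; lia.
  by have := wP m k; rewrite /B1 (_ : (m == n.+1) = false); [apply; lia|lia].
rewrite measure_countable_bigcup; last 2 first.
- by move=> y1; apply: measurableI => //; exact: measurable_future.
- by move=> y1 y2 _ _ [w [[/= <- _] [/= <- _]]].
rewrite -esumZr; last 2 first.
- by rewrite lee_fin; apply: prodr_ge0 => m _; apply: prodr_ge0 => k _; rewrite fine_ge0.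
- move=> y1; rewrite lee_fin mulr_ge0 ?fine_ge0//; apply: prodr_ge0 => k _.
  by rewrite -lee_fin -(@rP k 1%N).
apply: eq_esum => y1 _; have [_ ->] := IH y1 M (B1 y1) (ltnW nM).
rewrite -EFinM big_ltn// (row_probE y1) ?mulrA => [|k]; last by rewrite /B1 eqxx.
congr ((_ * _)%:E); apply: eq_big_nat => m /andP[nm _].
by apply: eq_bigr => k _; rewrite /B1 (_ : (m == n.+1) = false)//; lia.
Qed.

Lemma chain_step n y y' : markov_at n y ->
  P [set w | chain g noise y n.+1 w = y'] =
   (\esum_(y1 in [set: Zvec N])
      (fine (P [set w | chain g noise y n w = y1]) * transition y1 y')%:E)%E.
Proof.
move=> IH; have := chain_future_step y' (fun _ _ => setT) IH (ltnSn n).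
rewrite (@big_geq _ _ _ n.+2)// mule1 => <-.
by rewrite (_ : future _ _ _ = setT) ?setIT//; apply/seteqP; split.
Qed.

Lemma chain_future n y : markov_at n y.
Proof.
elim: n => [|n IH] y' M B nM.
  have [yy'|yy'] := pselect (y = y').
    rewrite (_ : [set w | _] = setT); last by apply/seteqP; split.
    by split; [exact: measurableT|rewrite setTI probability_setT/= mul1r future_prob].
  rewrite (_ : [set w | _] = set0); last by apply/seteqP; split.
  by split; [exact: measurable0|rewrite set0I measure0/= mul0r].
split; first exact: measurable_chainS.
rewrite chain_future_step// -chain_step// EFinM fineK// probability_fin//.
exact: measurable_chainS.
Qed.

Lemma Q0 y y' : Q g xi 0 y y' = (y == y')%:R.
Proof.
rewrite /Q; case: eqP => [yy'|yy'].
  by rewrite (_ : [set w | _] = setT) ?probability_setT//; apply/seteqP; split.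
by rewrite (_ : [set w | _] = set0) ?measure0//; apply/seteqP; split.
Qed.

Lemma Q_ge0 n y y' : 0 <= Q g xi n y y'.
Proof. by rewrite fine_ge0. Qed.

Lemma QS n y y'' : (Q g xi n.+1 y y'')%:E =
  (\esum_(y' in [set: Zvec N]) (Q g xi n y y' * transition y' y'')%:E)%E.
Proof.
rewrite -(chain_step _ (@chain_future n y)) fineK// probability_fin//.
exact: measurable_chainS (@chain_future n y).
Qed.
End Markov.

(** * Kernel numerators as sums over patterns *)

Section TableauSums.
Context {R : realType} {N : nat}.
Implicit Types (T : seq (seq 'I_N)) (z y : Zvec N).

Definition extend (x : R) (a : 'I_N -> R) (k : nat) : R := oapp a x (insub k).

Lemma extendE x a (k : 'I_N) : extend x a k = a k.
Proof. by rewrite /extend valK. Qed.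

Lemma extend_ind (Pr : R -> Prop) x a k : Pr x -> (forall i, Pr (a i)) -> Pr (extend x a k).
Proof. by rewrite /extend => Px Pa; case: insub => [i|] /=. Qed.

Lemma vsum_shape_belowS T (k : 'I_N) : semistandard T ->
  vsum (shape_below k.+1 T) - vsum (shape_below k T) = (count_mem k (flatten T))%:Z.
Proof.
move=> sT; rewrite /vsum -sumrB.
transitivity (\sum_(i < N) (count_mem k (row T i))%:Z).
  by apply: eq_bigr => i _; rewrite !ffunE count_belowS PoszD addrC addKr.
rewrite -(big_morph Posz PoszD (erefl (Posz 0))); congr Posz.
rewrite count_flatten sumnE big_map (big_nth [::]) -(big_mkord xpredT (fun i => count_mem k (row T i))).
rewrite (big_cat_nat (n := size T))//= ?semistandard_size// [X in (_ + X)%N]big1_seq ?addn0//.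
by move=> i /andP[_]; rewrite mem_index_iota => /andP[Ti _]; rewrite /row nth_default.
Qed.

Lemma weightE (alpha : 'I_N -> R) T : semistandard T ->
  weight alpha T = \prod_(0 <= j < N)
    extend 1 alpha j ^ (vsum (shape_below j.+1 T) - vsum (shape_below j T)).
Proof.
move=> sT; rewrite /weight big_mkord; apply: eq_bigr => k _.
by rewrite extendE vsum_shape_belowS.
Qed.

(** [z] prescribes the row lengths, so [T] is recovered by [reshape] from its number of rows and its
    flattening, a word of fixed length. *)
Lemma finite_tableaux z : finite_set [set T | semistandard T /\ sh T = z].
Proof.
pose m := (\sum_(0 <= i < N) `|coord z i|)%N.
pose s (n : nat) := mkseq (fun i => `|coord z i|%N) n.
pose f (a : 'I_N.+1 * m.-tuple 'I_N) := reshape (s a.1) a.2.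
apply: (@sub_finite_set _ _ (range f)); last exact/finite_image/finite_finset.
move=> T [sT shT].
have sizeT i : size (row T i) = `|coord z i|%N by rewrite -shT coord_sh.
have shapeT : shape T = s (size T).
  apply: (@eq_from_nth _ 0%N); rewrite size_map ?size_mkseq// => i iT.
  by rewrite (nth_map [::])// nth_mkseq// -sizeT.
have flatT : size (flatten T) == m.
  rewrite size_flatten sumnE shapeT /s big_map /m.
  rewrite [X in _ == X](big_cat_nat (n := size T))//= ?semistandard_size//.
  rewrite [X in (_ + X)%N]big1_seq ?addn0 /index_iota ?subn0//.
  move=> i /andP[_]; rewrite mem_iota => /andP[Ti _].
  by rewrite -sizeT /row nth_default.
have TN : (size T < N.+1)%N by rewrite ltnS semistandard_size.
exists (Ordinal TN, Tuple flatT) => //.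
by rewrite /f /= -shapeT flattenK.
Qed.

Lemma weight_ge0 (alpha : 'I_N -> R) T : (forall k, 0 < alpha k) -> 0 <= weight alpha T.
Proof. by move=> a0; apply: prodr_ge0 => k _; rewrite exprn_ge0// ltW. Qed.

Section Edges.
Variables (edge : seq (seq 'I_N) -> Zvec N) (eidx : nat -> nat).
Hypothesis edgeE : forall T k, semistandard T -> (k < N)%N ->
  coord (edge T) k = coord (shape_below k.+1 T) (eidx k).
Variable alpha : 'I_N -> R.
Hypothesis alpha_gt0 : forall k, 0 < alpha k.

Let al := extend 1 alpha.

Let al_gt0 k : 0 < al k. Proof. by apply: (@extend_ind (fun x => 0 < x)). Qed.

Definition edge_sum z y : R :=
  \sum_(T \in [set T | [/\ semistandard T, sh T = z & edge T = y]]) weight alpha T.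

Lemma edge_sumE z y : (edge_sum z y)%:E =
  (\esum_(T in [set T | [/\ semistandard T, sh T = z & edge T = y]]) (weight alpha T)%:E)%E.
Proof.
rewrite esum_fset_set//; last by move=> T _; exact: weight_ge0.
by apply: sub_finite_set (finite_tableaux z) => T [sT shT _].
Qed.

Lemma schurE z : (schur alpha z)%:E =
  (\esum_(T in [set T | semistandard T /\ sh T = z]) (weight alpha T)%:E)%E.
Proof.
rewrite esum_fset_set//; first exact: finite_tableaux.
by move=> T _; exact: weight_ge0.
Qed.

Lemma edge_sum_ge0 z y : 0 <= edge_sum z y.
Proof.
by rewrite -lee_fin edge_sumE esum_ge0// => T _; rewrite lee_fin weight_ge0.
Qed.

Lemma schur_ge0 z : 0 <= schur alpha z.
Proof.
by rewrite -lee_fin schurE esum_ge0// => T _; rewrite lee_fin weight_ge0.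
Qed.

Lemma edge_sum_le z y : edge_sum z y <= schur alpha z.
Proof.
rewrite -lee_fin edge_sumE schurE [leLHS]esum_mkcond [leRHS]esum_mkcond.
apply: le_esum => T _; case: ifPn => [/set_mem[sT shT _]|_]; first by rewrite mem_set.
by case: ifPn => // _; rewrite lee_fin weight_ge0.
Qed.

(** If [schur alpha z = 0], then [edge_sum], lying between [0] and it, vanishes too; so positivity
    of Schur polynomials need not be shown. *)
Lemma schur_edge_sum z y : schur alpha z * ((schur alpha z)^-1 * edge_sum z y) = edge_sum z y.
Proof.
have [s0|s0] := eqVneq (schur alpha z) 0; last by rewrite mulrA divff// mul1r.
rewrite s0 mul0r; apply/esym/eqP; rewrite eq_le edge_sum_ge0 andbT.
by rewrite -s0 edge_sum_le.
Qed.

Lemma tableauxNE z : tableaux N z = [set T | semistandard T /\ sh T = z].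
Proof.
apply/seteqP; split=> T; first by move=> [].
by move=> [sT <-]; exact: tableauxN.
Qed.

Lemma edge_is_prod y T : semistandard T ->
  \prod_(0 <= k < N) edge_is (R := R) eidx y k (shape_below k.+1 T) (shape_below k T) =
  (edge T == y)%:R.
Proof.
move=> sT; rewrite /edge_is; case: eqP => [<-|ne].
  by rewrite big_nat_cond big1// => k /andP[/andP[_ kN] _]; rewrite -edgeE// eqxx.
have /existsNP[k /eqP ke] : ~ (coord (edge T) =1 coord y).
  by move=> e; apply: ne; exact: coord_inj.
have kN : (k < N)%N.
  by rewrite ltnNge; apply: contra ke => Nk; rewrite !coord_out.
rewrite (bigD1_seq k) ?mem_index_iota ?iota_uniq//=.
by rewrite -edgeE// (negbTE ke) mul0r.
Qed.

Lemma edge_sum_gt z y : (edge_sum z y)%:E = gt_sum al (edge_is eidx y) N z.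
Proof.
rewrite gt_sum_tableaux//; last by move=> j; exact: ltW.
rewrite edge_sumE tableauxNE.
rewrite [RHS](@esum_if0 _ _ _ [set T | [/\ semistandard T, sh T = z & edge T = y]]).
- apply: eq_esum => T [sT _ eT]; rewrite /pattern_weight big_split/= edge_is_prod//.
  by rewrite eT eqxx mulr1 weightE.
- by move=> T [].
move=> T [sT shT] ne; rewrite /pattern_weight big_split/= edge_is_prod//.
by case: eqP => [e|_]; [case: ne|rewrite mulr0].
Qed.

Variable r : nat -> int -> int -> int -> int -> R.
Hypothesis r_ge0 : forall k a b c e, 0 <= r k a b c e.
Hypothesis r_first : forall a b c b' c' e, r 0 a b c e = r 0 a b' c' e.

Lemma edge_sum_transition z y :
  (\esum_(y' in [set: Zvec N]) (edge_sum z y' * transition r y' y)%:E =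
   gt_sum al (edge_step eidx r y) N z)%E.
Proof.
have t_ge0 y' : 0 <= transition r y' y by apply: prodr_ge0.
rewrite gt_sum_tableaux//; [|by move=> j; exact: ltW|by move=> *; exact: r_ge0].
rewrite tableauxNE.
transitivity (\esum_(T in [set T | semistandard T /\ sh T = z])
   (weight alpha T * transition r (edge T) y)%:E)%E; last first.
  apply: eq_esum => T [sT _]; rewrite /pattern_weight big_split/= weightE//.
  congr ((_ * _)%:E); rewrite /transition [RHS]big_mkord; apply: eq_bigr => k _.
  (* At [k = 0] the truncated predecessor gives the two sides different neighbour arguments;
     [r_first] identifies them. *)
  rewrite /edge_step edgeE//; case: k => -[|k] kN /=; first exact: r_first.
  by rewrite edgeE// ltnW.
rewrite [RHS](@esum_fiber _ _ _ _ setT edge)//; last first.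
  by move=> T; rewrite lee_fin mulr_ge0// weight_ge0.
apply: eq_esum => y' _; rewrite EFinM edge_sumE -esumZr ?lee_fin//; last first.
  by move=> T; rewrite lee_fin weight_ge0.
rewrite (_ : [set T | _] `&` _ = [set T | [/\ semistandard T, sh T = z & edge T = y']]).
  by apply: eq_esum => T [_ _ ->]; rewrite EFinM.
by apply/seteqP; split=> T /=; [case=> -[]|case].
Qed.
End Edges.
End TableauSums.

(** * The intertwining relation, uniformly in the four cases *)

Section Intertwining.
Context {R : realType} {d : measure_display} {Omega : measurableType d}.
Context {P : probability Omega R} {N : nat}.
Variables (xi : 'I_N -> nat -> {RV P >-> nat}) (hxi : independent_noise xi).
Variables (p alpha : 'I_N -> R) (X : set nat).
Hypothesis p_le1 : forall k, p k <= 1.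
Hypothesis alpha_gt0 : forall k, 0 < alpha k.
Hypothesis noise_law : forall k m x, (1 <= m)%N ->
  P [set w | xi k m w = x] = (if x \in X then (1 - p k) * alpha k ^+ x else 0)%:E.
Variables (g : update_rule) (strip : Zvec N -> Zvec N -> Prop) (eidx : nat -> nat).
Variables (edge : seq (seq 'I_N) -> Zvec N) (S : set (Zvec N)).
Hypothesis strip_le : forall mu la i, strip mu la -> coord mu i <= coord la i.
Hypothesis strip00 : strip [ffun => 0] [ffun => 0].
Hypothesis localP : forall al : R, 0 < al -> local_identity g X strip eidx al.
Hypothesis edgeE : forall T k, semistandard T -> (k < N)%N ->
  coord (edge T) k = coord (shape_below k.+1 T) (eidx k).
Hypothesis edge_S : forall T, semistandard T -> S (edge T).
Variable f : nat -> int -> R.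
Hypothesis f0 : forall k, f 0 k = (k == 0)%:R.
Hypothesis fS : forall n z z', Wge0 z -> Wge0 z' ->
  (forall u, Wge0 u -> 0 <= strip_det f n z u) ->
  (strip_det f n.+1 z z')%:E =
  (\esum_(u in [set u | Wge0 u /\ strip u z']) (strip_det f n z u)%:E)%E.
Implicit Types (z y : Zvec N).

Let al := extend 1 alpha.
Let q := extend 1 (fun k => 1 - p k).

(** Read off at time [1]; by [noise_law] every time [m >= 1] gives the same value. *)
Definition noise_kernel k a b c e : R :=
  if insub k is Some k' then
    fine (P (xi k' 1%N @^-1` [set x | update g k a b c x = e])) else 0.

Let r := noise_kernel.

Let al_gt0 k : 0 < al k. Proof. by apply: (@extend_ind _ _ (fun x => 0 < x)). Qed.

Let q_ge0 k : 0 <= q k.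
Proof. by apply: (@extend_ind _ _ (fun x => 0 <= x)) => // i; rewrite subr_ge0. Qed.

Lemma noise_preimage (k : 'I_N) m B : (1 <= m)%N ->
  P (xi k m @^-1` B) = (\esum_(x in [set x | X x /\ B x]) ((1 - p k) * alpha k ^+ x)%:E)%E.
Proof.
move=> m1; rewrite measure_nat_preimage; last first.
  by move=> x; apply: (measurable_preimage xi k m [set x]).
rewrite (@esum_if0 _ _ B [set x | X x /\ B x]) => [|x []//|x Bx nX].
  by apply: eq_esum => x [Xx _]; rewrite noise_law// mem_set.
by rewrite noise_law// memNset// => Xx; apply: nX.
Qed.

Lemma noise_kernelP (k : 'I_N) m a b c e : (1 <= m)%N ->
  P (xi k m @^-1` [set x | update g k a b c x = e]) = (r k a b c e)%:E.
Proof.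
move=> m1; rewrite /r /noise_kernel valK fineK; last first.
  by rewrite probability_fin//; exact: measurable_preimage.
by rewrite !noise_preimage.
Qed.

Lemma noise_kernelE k a b c e : (k < N)%N -> (r k a b c e)%:E =
  (\esum_(x in [set x | X x /\ update g k a b c x = e]) (q k * al k ^+ x)%:E)%E.
Proof.
move=> kN; rewrite -(@noise_kernelP (Ordinal kN) 1%N)// noise_preimage//.
by apply: eq_esum => x _; rewrite -[k in q k]/(nat_of_ord (Ordinal kN)) -[k in al k]/(nat_of_ord (Ordinal kN)) /q /al !extendE.
Qed.

Let r_ge0 k a b c e : 0 <= r k a b c e.
Proof. by rewrite /r /noise_kernel; case: insub => // k'; rewrite fine_ge0. Qed.

Let r_first a b c b' c' e : r 0 a b c e = r 0 a b' c' e.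
Proof. by []. Qed.

Lemma strip_det_ge0 n z z' : Wge0 z -> Wge0 z' -> 0 <= strip_det f n z z'.
Proof.
move=> Wz; elim: n z' => [|n IH] z' Wz'; first by rewrite strip_det0// ler0n.
by rewrite -lee_fin fS// esum_ge0// => u [Wu _]; rewrite lee_fin IH.
Qed.

Let numer z y : R := edge_sum edge alpha z y.
Let c : R := \prod_(0 <= k < N) q k.

Let c_ge0 : 0 <= c. Proof. exact: prodr_ge0. Qed.

Let numer_ge0 z y : 0 <= numer z y. Proof. exact: edge_sum_ge0. Qed.

Lemma numer_step z y : Wge0 z ->
  (\esum_(y' in [set: Zvec N]) (numer z y' * transition r y' y)%:E =
   c%:E * \esum_(z' in [set z' | strip z z']) (numer z' y)%:E)%E.
Proof.
move=> /Wge0E dz; rewrite (edge_sum_transition edgeE)//.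
rewrite (gt_sum_step (q := q) (g := g) (X := X) (strip := strip))//.
- by congr (_ * _)%E; apply: eq_esum => z' _; rewrite /numer (edge_sum_gt edgeE).
- by move=> *; exact: noise_kernelE.
- by move=> k; exact: localP.
Qed.

Lemma numer_eq0 z y : ~ Wge0 z -> numer z y = 0.
Proof.
move=> nz; apply: EFin_inj; rewrite /numer edge_sumE// esum1// => T [sT shT _].
case: nz; rewrite -shT; apply/Wge0E => i; rewrite !coord_sh// lez_nat.
exact: size_row sT (leqnSn N).
Qed.

(** Induction on [n], splitting off the last step: [fS] turns the determinant at [n.+1] into one at
    [n] followed by a strip, [numer_step] trades the strip for one transition of the edge, and the
    induction hypothesis with [QS] rebuilds the chain. *)
Lemma numer_intertwine n z y : Wge0 z ->
  (\esum_(z' in @Wge0 N) (c ^+ n * strip_det f n z z' * numer z' y)%:E =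
   \esum_(y' in [set: Zvec N]) (numer z y' * Q g xi n y' y)%:E)%E.
Proof.
move=> Wz; elim: n y => [|n IH] y.
  transitivity ((numer z y)%:E).
    rewrite (@esum_if0 _ _ _ [set z]) => [||z' Wz' /eqP zz']; last 2 first.
    - by move=> _ ->.
    - by rewrite strip_det0// (negbTE zz') mulr0 mul0r.
    by rewrite esum_set1 strip_det0// eqxx expr0 !mul1r// lee_fin.
  rewrite (@esum_if0 _ _ _ [set y])// => [|y' _ /eqP yy'].
    by rewrite esum_set1 Q0 eqxx mulr1// lee_fin.
  by rewrite Q0 (negbTE yy') mulr0.
have t_ge0 y1 y2 : 0 <= transition r y1 y2 by apply: prodr_ge0.
pose D (z' : Zvec N) := strip_det f n z z'.
transitivity (\esum_(z' in @Wge0 N) ((c ^+ n * D z')%:E *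
    (c%:E * \esum_(z'' in [set z'' | strip z' z'']) (numer z'' y)%:E)))%E.
  (* [D] is known to be nonnegative on [Wge0] only, while the exchange lemmas ask for nonnegative
     terms at all indices; the absolute value changes nothing on [Wge0]. *)
  transitivity (\esum_(z'' in @Wge0 N) \esum_(z' in [set z' | Wge0 z' /\ strip z' z''])
      (c ^+ n.+1 * `|D z'| * numer z'' y)%:E)%E.
    apply: eq_esum => z'' Wz''.
    rewrite mulrAC EFinM fS//; last by move=> u Wu; exact: strip_det_ge0.
    rewrite (eq_esum (b := fun u => (`|D u|)%:E)) => [|u [Wu _]]; last first.
      by rewrite ger0_norm//; exact: strip_det_ge0.
    rewrite -esumZl; last 2 first.
    - by rewrite lee_fin mulr_ge0// exprn_ge0.
    - by move=> u; rewrite lee_fin.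
    by apply: eq_esum => u _; rewrite -EFinM mulrAC.
  rewrite (@esum_exchange _ _ _ _ _ (@Wge0 N) (fun z' => [set z'' | Wge0 z'' /\ strip z' z''])).
  - apply: eq_esum => z' Wz'; rewrite muleA -EFinM -esumZl; last 2 first.
    + by rewrite lee_fin !mulr_ge0 ?exprn_ge0//; exact: strip_det_ge0.
    + by move=> u; rewrite lee_fin.
    rewrite [RHS](@esum_if0 _ _ _ [set z'' | Wge0 z'' /\ strip z' z'']).
    + apply: eq_esum => z'' _; rewrite -EFinM ger0_norm; last exact: strip_det_ge0.
      by congr (_%:E); rewrite exprSr; ring.
    + by move=> z'' [].
    + move=> z'' /= s nW; rewrite numer_eq0 ?mule0// => Wz''; exact: nW.
  - by move=> z'' z'; rewrite lee_fin !mulr_ge0 ?exprn_ge0.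
  - by move=> z'' z' /=; tauto.
transitivity (\esum_(y' in [set: Zvec N]) ((\esum_(z' in @Wge0 N)
   (c ^+ n * `|D z'| * numer z' y')%:E) * (transition r y' y)%:E))%E.
  rewrite (eq_esum (b := fun z' => \esum_(y' in [set: Zvec N])
      (c ^+ n * `|D z'| * numer z' y' * transition r y' y)%:E)%E) => [|z' Wz'].
    rewrite (@esum_exchange _ _ _ _ _ setT (fun=> @Wge0 N)); last 2 first.
    - by move=> z' y'; rewrite lee_fin !mulr_ge0 ?exprn_ge0.
    - by move=> z' y' /=; tauto.
    apply: eq_esum => y' _; rewrite -esumZr ?lee_fin//; last first.
      by move=> z'; rewrite lee_fin !mulr_ge0 ?exprn_ge0.
  rewrite -numer_step// -esumZl; last 2 first.
  - by rewrite lee_fin mulr_ge0 ?exprn_ge0//; exact: strip_det_ge0.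
  - by move=> y'; rewrite lee_fin mulr_ge0.
  apply: eq_esum => y' _; rewrite -EFinM mulrA ger0_norm//; exact: strip_det_ge0.
transitivity (\esum_(y' in [set: Zvec N]) \esum_(y'' in [set: Zvec N])
    (numer z y'' * (Q g xi n y'' y' * transition r y' y))%:E)%E.
  apply: eq_esum => y' _.
  rewrite (eq_esum (b := fun z' => (c ^+ n * strip_det f n z z' * numer z' y')%:E)) => [|z' Wz'].
    rewrite IH -esumZr ?lee_fin// => [|y'']; last by rewrite lee_fin mulr_ge0 ?Q_ge0.
    by apply: eq_esum => y'' _; rewrite -EFinM mulrA.
  by rewrite ger0_norm//; exact: strip_det_ge0.
rewrite (@esum_exchange _ _ _ _ _ setT (fun=> setT))//; last first.
  by move=> y' y''; rewrite lee_fin !mulr_ge0 ?Q_ge0.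
apply: eq_esum => y'' _; rewrite EFinM (QS hxi noise_kernelP) -esumZl ?lee_fin//.
by move=> y'; rewrite lee_fin mulr_ge0 ?Q_ge0.
Qed.

(** Only the constant [1 / schur alpha z] is left beside the numerators, and the sum over [S]
    extends to all vectors because numerators vanish off the edges of tableaux. *)
Lemma intertwines_of_local n :
  intertwines S (Pkernel p alpha f n) (edge_kernel edge alpha) (Q g xi n).
Proof.
move=> z y Wz Sy; have s_ge0 z' : 0 <= schur alpha z' by exact: schur_ge0.
have PE z' : Pkernel p alpha f n z z' * edge_kernel edge alpha z' y =
    (schur alpha z)^-1 * (c ^+ n * strip_det f n z z' * numer z' y).
  rewrite /numer -(schur_edge_sum edge alpha_gt0) /Pkernel /strip_det.
  have -> : \prod_(k < N) (1 - p k) ^+ n = c ^+ n.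
    rewrite prodrXl /c big_mkord; congr (_ ^+ n).
    by apply: eq_bigr => k _; rewrite /q extendE.
  by rewrite /edge_kernel -/(edge_sum _ _ _ _); ring.
have W_ge0 z' : Wge0 z' -> 0 <= c ^+ n * strip_det f n z z' * numer z' y.
  by move=> Wz'; rewrite !mulr_ge0 ?exprn_ge0//; exact: strip_det_ge0.
rewrite !ssumE; last 2 first.
- move=> y' _; rewrite mulr_ge0 ?Q_ge0// mulr_ge0 ?invr_ge0//.
  exact: edge_sum_ge0.
- by move=> z' Wz'; rewrite PE mulr_ge0 ?invr_ge0 ?W_ge0.
transitivity ((schur alpha z)^-1%:E *
    \esum_(y' in [set: Zvec N]) (numer z y' * Q g xi n y' y)%:E)%E.
  rewrite -numer_intertwine//.
  rewrite [X in (_ * X)%E](eq_esum (b := fun z' => (c ^+ n * `|strip_det f n z z'| * numer z' y)%:E)); last first.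
    by move=> z' Wz'; rewrite ger0_norm//; exact: strip_det_ge0.
  rewrite -esumZl ?lee_fin ?invr_ge0//; last first.
    by move=> z'; rewrite lee_fin !mulr_ge0 ?exprn_ge0.
  apply: eq_esum => z' Wz'; rewrite -EFinM PE ger0_norm//; exact: strip_det_ge0.
rewrite -esumZl ?lee_fin ?invr_ge0//; last first.
  by move=> y'; rewrite lee_fin mulr_ge0 ?Q_ge0.
rewrite (@esum_if0 _ _ _ S)//; first by apply: eq_esum => y' _; rewrite -EFinM mulrA.
move=> y' _ nS; rewrite (_ : numer z y' = 0) ?mul0r ?mule0//.
apply: EFin_inj; rewrite /numer edge_sumE// esum1// => T [sT _ eT].
by case: nS; rewrite -eT; exact: edge_S.
Qed.
End Intertwining.

(** * The two edges as parts of the pattern, and the Bernoulli law *)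

Section Edges.
Context {N : nat}.
Implicit Types T : seq (seq 'I_N).

Lemma coord_redge T k : semistandard T -> (k < N)%N ->
  coord (redge T) k = coord (shape_below k.+1 T) 0.
Proof.
move=> sT kN; rewrite coord_shape_below//.
by rewrite -[k in LHS]/(nat_of_ord (Ordinal kN)) coordE ffunE.
Qed.

Lemma coord_ledge T k : semistandard T -> (k < N)%N ->
  coord (ledge T) k = coord (shape_below k.+1 T) k.
Proof.
move=> sT kN; rewrite coord_shape_below//.
rewrite -[k in LHS]/(nat_of_ord (Ordinal kN)) coordE ffunE.
by rewrite (count_belowS (Ordinal kN)) count_below_row_eq0.
Qed.

Lemma redge_What T : semistandard T -> What (redge T).
Proof.
move=> sT i j ij; rewrite -!coordE !coord_redge// !coord_shape_below// lez_nat.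
exact: count_below_mono.
Qed.

Lemma ledge_W T : semistandard T -> W (ledge T).
Proof.
move=> sT i j ij; rewrite -!coordE !coord_ledge// !coord_shape_below// lez_nat.
have /semistandardP[_ _ interT] := sT.
rewrite -(subnK ij); elim: (j - i)%N => // m IH; apply: leq_trans IH.
exact: interT.
Qed.
End Edges.

(** The value [1] has probability [p = (1 - p) * pi_]. The values [0] and [1] already exhaust the
    total mass, so any other value has probability zero. *)
Lemma bernoulli_law (R : realType) (d : measure_display) (Omega : measurableType d)
    (P : probability Omega R) (N : nat) (p pi_ : 'I_N -> R)
    (xi : 'I_N -> nat -> {RV P >-> nat}) :
  (forall k, 0 < p k < 1) -> (forall k, pi_ k = p k / (1 - p k)) ->
  bernoulli_noise p xi -> forall k m x, (1 <= m)%N ->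
  P [set w | xi k m w = x] =
    (if x \in [set x : nat | (x <= 1)%N] then (1 - p k) * pi_ k ^+ x else 0)%:E.
Proof.
move=> hp hpi hxi k m x m1; have [P1 P0] := hxi k m m1.
have /andP[p_gt0 p_lt1] := hp k.
have mX y : measurable [set w | xi k m w = y].
  exact: (measurable_preimage xi k m [set y]).
case: x => [|[|x]]; [by rewrite mem_set// expr0 mulr1| |].
  rewrite mem_set// expr1 hpi P1 mulrCA divff ?mulr1//.
  by rewrite subr_eq0 gt_eqF.
rewrite memNset//; apply/eqP; rewrite eq_le measure_ge0 andbT.
have disj a b : a <> b -> [set w | xi k m w = a] `&` [set w | xi k m w = b] = set0.
  by move=> ab; apply/seteqP; split=> // w [/= -> /ab].
have := probability_le1 P (measurableU _ _ (measurableU _ _ (mX 0%N) (mX 1%N)) (mX x.+2)).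
have m01 := measurableU _ _ (mX 0%N) (mX 1%N).
have h01 : P ([set w | xi k m w = 0%N] `|` [set w | xi k m w = 1%N]) = 1%E.
  apply: (eq_trans (measureU P (mX 0%N) (mX 1%N) _)); first exact: disj.
  transitivity ((1 - p k)%:E + (p k)%:E)%E; last by rewrite -EFinD subrK.
  by congr adde.
rewrite measureU//; last by rewrite setIUl !disj// setU0.
rewrite [X in (X + _)%R](_ : _ = 1%E); last exact: h01.
by rewrite -[X in (_ <= X)%E]adde0 leeD2lE.
Qed.

Theorem mainTheorem2 (R : realType) (N : nat) (hN : (1 <= N)%N)
    (p : 'I_N -> R) (hp : forall k, 0 < p k < 1)
    (pi_ : 'I_N -> R) (hpi : forall k, pi_ k = p k / (1 - p k))
    (d : measure_display) (Omega : measurableType d)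
    (P : probability Omega R) (xi : 'I_N -> nat -> {RV P >-> nat})
    (hxi : independent_noise xi) :
  (geometric_noise p xi ->
     forall n : nat,
       intertwines (@What N) (Pkernel p p (@wfun R) n) (Khat p)
         (Q ruleA xi n) /\
       intertwines (@W N) (Pkernel p p (@wfun R) n) (K p)
         (Q ruleC xi n)) /\
  (bernoulli_noise p xi ->
     forall n : nat,
       intertwines (@W N) (Pkernel p pi_ (@vfun R) n) (K pi_)
         (Q ruleB xi n) /\
       intertwines (@What N) (Pkernel p pi_ (@vfun R) n) (Khat pi_)
         (Q ruleD xi n)).
Proof.
have p_le1 k : p k <= 1 by have /andP[_ /ltW] := hp k.
have p_gt0 k : 0 < p k by have /andP[] := hp k.
have pi_gt0 k : 0 < pi_ k by have /andP[p0 p1] := hp k; rewrite hpi divr_gt0 ?subr_gt0.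
have inter00 : interlace [ffun => 0] ([ffun => 0] : Zvec N).
  by move=> i; rewrite !coord0.
have vstrip00 : vstrip [ffun => 0] ([ffun => 0] : Zvec N).
  by move=> i; rewrite !coord0.
have inter_le (mu la : Zvec N) i : interlace mu la -> coord mu i <= coord la i.
  by move=> /(_ i)/andP[].
have vstrip_le (mu la : Zvec N) i : vstrip mu la -> coord mu i <= coord la i.
  by move=> /(_ i)/andP[].
split=> [geo|ber] n.
  have law k m x : (1 <= m)%N -> P [set w | xi k m w = x] =
      (if x \in [set: nat] then (1 - p k) * p k ^+ x else 0)%:E.
    by move=> m1; rewrite in_setT geo.
  split.
  - exact: (intertwines_of_local hxi p_le1 p_gt0 law inter_le inter00
      (@ruleA_local_identity R N) (@coord_redge N) (@redge_What N)
      (@wfun0 R) (@strip_det_wfunS_esum R N)).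
  - exact: (intertwines_of_local hxi p_le1 p_gt0 law inter_le inter00
      (@ruleC_local_identity R N) (@coord_ledge N) (@ledge_W N)
      (@wfun0 R) (@strip_det_wfunS_esum R N)).
have law := bernoulli_law hp hpi ber.
split.
- exact: (intertwines_of_local hxi p_le1 pi_gt0 law vstrip_le vstrip00
    (@ruleB_local_identity R N) (@coord_ledge N) (@ledge_W N)
    (@vfun0 R) (@strip_det_vfunS_esum R N)).
- exact: (intertwines_of_local hxi p_le1 pi_gt0 law vstrip_le vstrip00
    (@ruleD_local_identity R N) (@coord_redge N) (@redge_What N)
    (@vfun0 R) (@strip_det_vfunS_esum R N)).
Qed.
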